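(* Let $-1\le p<1$ be non-zero. Then there exist $C\in\mathcal{K}_{(0)}(\mathbb{C})$ and an origin-symmetric ellipsoid $K\subseteq\mathbb{C}^n$ such that $\mathrm{I}_{C,p}K$ is not convex.
   Context: Identify $\mathbb{C}^n\cong\mathbb{R}^{2n}$ with Euclidean inner product $\langle\cdot,\cdot\rangle$ and unit sphere $\mathbb{S}^{2n-1}$; ellipsoids are (real) ellipsoids in $\mathbb{R}^{2n}$ with non-empty interior. $\mathcal{K}_{(0)}(\mathbb{C})$ is the set of compact convex subsets of $\mathbb{C}\cong\mathbb{R}^2$ containing the origin in their interior. A star body is a compact set, star-shaped with respect to the origin, whose radial function $\rho_K(u)=\sup\{\lambda\ge0:\lambda u\in K\}$, $u\neq0$, is positive and continuous. For $C\in\mathcal{K}_{(0)}(\mathbb{C})$, $p>-2$ non-zero and a star body $K\subseteq\mathbb{C}^n$, the complex $L_p$-intersection body $\mathrm{I}_{C,p}K$ is the star body with radial function $\rho_{\mathrm{I}_{C,p}K}(u)^{-p}=\int_K h_{Cu}(x)^p\,dx$, $u\in\mathbb{S}^{2n-1}$, where $Cu=\{cu:c\in C\}$ and $h_L(x)=\sup\{\langle x,y\rangle:y\in L\}$. *)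

(* Defs.v *)
From HB Require Import structures.
From mathcomp Require Import all_boot all_order all_algebra.
From mathcomp Require Import all_classical all_reals all_analysis.
Set Implicit Arguments.
Unset Strict Implicit.
Unset Printing Implicit Defensive.
Import Order.TTheory GRing.Theory Num.Theory.
Import numFieldNormedType.Exports.
Local Open Scope classical_set_scope.
Local Open Scope ring_scope.

(* C^n = R^(2n) is the space 'M[R]_(n, 2): row i holds the real part (column 0)
   and the imaginary part (column 1) of the i-th complex coordinate. In
   particular C = 'rV[R]_2. The topology, the R-module structure and convexity
   are the library's on 'M[R]_(n, 2); its norm `|_| is the sup norm, so the
   Euclidean one is [enorm] below. *)

Section EuclideanStructure.
Context {R : realType} {n : nat}.
Implicit Types (x y u : 'M[R]_(n, 2)) (K L : set 'M[R]_(n, 2)).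

Definition dot x y : R := \sum_(i < n) \sum_(j < 2) x i j * y i j.

Definition enorm x : R := Num.sqrt (dot x x).

Definition sphere : set 'M[R]_(n, 2) := [set u | enorm u = 1].

(* (c0 + i c1) (u0 + i u1) = (c0 u0 - c1 u1) + i (c0 u1 + c1 u0),
   in each coordinate *)
Definition cscale (c : 'rV[R]_2) u : 'M[R]_(n, 2) :=
  \matrix_(i, j) (if j == 0 then c 0 0 * u i 0 - c 0 1 * u i 1
                  else c 0 0 * u i 1 + c 0 1 * u i 0).

Definition csetscale (C : set 'rV[R]_2) u : set 'M[R]_(n, 2) :=
  [set cscale c u | c in C].

Definition support_fun L x : R := sup [set dot x y | y in L].

Definition radial K u : R := sup [set l : R | 0 <= l /\ K (l *: u)].

Definition star_body K :=
  [/\ compact K,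
      forall x (t : R), K x -> 0 <= t <= 1 -> K (t *: x) &
      forall u, u != 0 -> 0 < radial K u /\ {for u, continuous (radial K)}].

Definition origin_symmetric K := forall x, K x -> K (- x).

Definition ellipsoid K :=
  (exists (f : {linear 'M[R]_(n, 2) -> 'M[R]_(n, 2)}) (v : 'M[R]_(n, 2)),
     K = [set v + f y | y in [set y | enorm y <= 1]]) /\
  K° !=set0.

End EuclideanStructure.

Definition convex_body0 {R : realType} (C : set 'rV[R]_2) :=
  [/\ compact C, convex_set C & C° 0].

(* The library has no Lebesgue measure on R^m for general m: it is built here
   on the measurable type m.-tuple R as an iterated product measure, transported
   along (x, t) |-> x :: t. *)
Section LebesgueTuple.
Context {R : realType}.
Local Open Scope ereal_scope.

Definition tuple_cons (m : nat) (xt : R * m.-tuple R) : m.+1.-tuple R :=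
  [the m.+1.-tuple R of xt.1 :: xt.2].

Lemma measurable_tuple_cons m : measurable_fun [set: R * m.-tuple R]
  (@tuple_cons m).
Proof. exact: measurable_cons. Qed.

Section step.
Variables (m : nat) (mu : {sigma_finite_measure set (m.-tuple R) -> \bar R}).

Definition lebesgue_cons : set (m.+1.-tuple R) -> \bar R :=
  pushforward (@lebesgue_measure R \x mu) (@tuple_cons m).

Let mf := @measurable_tuple_cons m.

Let lebesgue_cons0 : lebesgue_cons set0 = 0.
Proof. exact: measure0. Qed.

Let lebesgue_cons_ge0 A : 0 <= lebesgue_cons A.
Proof. exact: measure_ge0. Qed.

Let lebesgue_cons_sigma_additive : semi_sigma_additive lebesgue_cons.
Proof. exact: measure_semi_sigma_additive. Qed.

HB.instance Definition _ := isMeasure.Build _ _ _ lebesgue_cons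
  lebesgue_cons0 lebesgue_cons_ge0 lebesgue_cons_sigma_additive.

Lemma lebesgue_cons_sigma_finite : sigma_finite setT lebesgue_cons.
Proof.
have /sigma_finiteP[F [TF ndF Foo]] := sigma_finiteT (@lebesgue_measure R).
have /sigma_finiteP[G [TG ndG Goo]] := sigma_finiteT mu.
pose g1 (t : m.+1.-tuple R) : R := thead t.
pose g2 (t : m.+1.-tuple R) : m.-tuple R := [tuple of behead t].
have mg1 : measurable_fun setT g1 by exact: measurable_tnth.
have mg2 : measurable_fun setT g2 by exact: measurable_behead.
exists (fun k => (g1 @^-1` F k) `&` (g2 @^-1` G k)).
  apply/seteqP; split => // t _.
  have [k _ Fk] : (\bigcup_i F i) (g1 t) by rewrite -TF.
  have [l _ Gl] : (\bigcup_i G i) (g2 t) by rewrite -TG.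
  exists (maxn k l) => //; split.
    by have /subsetPset := ndF _ _ (leq_maxl k l); exact.
  by have /subsetPset := ndG _ _ (leq_maxr k l); exact.
move=> k; have [mFk Fk] := Foo k; have [mGk Gk] := Goo k; split.
  by apply: measurableI; rewrite -[_ @^-1` _]setTI; [exact: mg1|exact: mg2].
rewrite /lebesgue_cons /pushforward.
rewrite [X in (_ \x _) X](_ : _ = F k `*` G k).
  by rewrite product_measure1E// lte_mul_pinfty// ge0_fin_numE.
have g1E x t : g1 (tuple_cons (x, t)) = x by [].
have g2E x t : g2 (tuple_cons (x, t)) = t by exact/val_inj.
by apply/seteqP; split => -[x t] /=; rewrite g1E g2E.
Qed.

HB.instance Definition _ :=
  @Measure_isSigmaFinite.Build _ _ _ lebesgue_cons lebesgue_cons_sigma_finite.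

End step.

Fixpoint lebesgue_tuple (m : nat) :
    {sigma_finite_measure set (m.-tuple R) -> \bar R} :=
  match m with
  | 0 => @dirac _ (0.-tuple R) [tuple] R
  | m'.+1 => lebesgue_cons (lebesgue_tuple m')
  end.

Lemma lebesgue_tuple_box m (A : 'I_m -> set R) :
  (forall i, measurable (A i)) ->
  lebesgue_tuple m [set t | forall i, A i (tnth t i)] =
  \prod_(i < m) lebesgue_measure (A i).
Proof.
elim: m A => [|m IH] A mA.
  by rewrite big_ord0 /= diracE mem_set//= => -[].
rewrite big_ord_recl /= /lebesgue_cons /pushforward.
rewrite -(IH (fun i => A (lift ord0 i)))//.
rewrite -product_measure1E//; last first.
  rewrite (_ : [set _ | _] =
      \bigcap_(i : 'I_m) (fun t => tnth t i) @^-1` (A (lift ord0 i))); last first.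
    by apply/seteqP; split => t /= h i *; exact: h.
  apply: fin_bigcap_measurable => // i _.
  by rewrite -[_ @^-1` _]setTI; exact: measurable_tnth.
  exact: mA.
congr product_measure1; apply/seteqP; split => -[x t] /=.
  move=> h; split; first by have := h ord0; rewrite tnth0.
  by move=> i; have := h (lift ord0 i); rewrite tnthS.
move=> [hx ht] i; case: (unliftP ord0 i) => [j ->|->]; first by rewrite tnthS.
by rewrite tnth0.
Qed.

End LebesgueTuple.

Section IntersectionBody.
Context {R : realType} {n : nat}.
Implicit Types (x u : 'M[R]_(n, 2)) (K L : set 'M[R]_(n, 2)).

Definition point_of_tuple (t : (n * 2).-tuple R) : 'M[R]_(n, 2) :=
  vec_mx (\row_k tnth t k).

(* \int_K h_(Cu)(x)^p dx. The library's convention 0 `^ p = 0 for p < 0 is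
   harmless: for u != 0 and 0 in the interior of C, h_(Cu)(x) vanishes only when
   x is orthogonal to u over the complex numbers, which is a null set. *)
Definition support_integral (C : set 'rV[R]_2) (p : R) K u : \bar R :=
  (\int[lebesgue_tuple (n * 2)]_(t in point_of_tuple @^-1` K)
     (support_fun (csetscale C u) (point_of_tuple t) `^ p)%:E)%E.

Definition Ip_radial C p K u : R := fine (support_integral C p K u) `^ (- p^-1).

Definition complex_Lp_intersection_body C p K : set 'M[R]_(n, 2) :=
  [set x | exists u (l : R),
     [/\ sphere u, 0 <= l <= Ip_radial C p K u & x = l *: u]].

Lemma enormZ (l : R) x : 0 <= l -> enorm (l *: x) = l * enorm x.
Proof.
move=> l0; rewrite /enorm.
have -> : dot (l *: x) (l *: x) = l ^+ 2 * dot x x.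
  rewrite /dot mulr_sumr; apply: eq_bigr => i _.
  by rewrite mulr_sumr; apply: eq_bigr => j _; rewrite !mxE mulrACA -expr2.
by rewrite sqrtrM ?sqr_ge0// sqrtr_sqr ger0_norm.
Qed.

Lemma enorm_eq0 x : enorm x = 0 -> x = 0.
Proof.
move=> /eqP; rewrite sqrtr_eq0 => x0.
have p i j : 0 <= x i j * x i j by rewrite -expr2 sqr_ge0.
have q i : 0 <= \sum_(j < 2) x i j * x i j by exact: sumr_ge0.
have /eqP : dot x x == 0 by rewrite eq_le x0/=; exact: sumr_ge0.
move=> /(psumr_eq0P (fun i _ => q i)) h; apply/matrixP => i j; rewrite mxE.
have /eqP := psumr_eq0P (fun j _ => p i j) (h i isT) (i := j) isT.
by rewrite -expr2 sqrf_eq0 => /eqP.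
Qed.

Lemma sphere_neq0 u : sphere u -> u != 0.
Proof.
move=> su; apply/eqP => u0; have := enormZ u (lexx 0).
by rewrite scale0r mul0r -u0 su => /eqP; rewrite oner_eq0.
Qed.

Lemma radial_complex_Lp_intersection_body_Ip C (p : R) K u : sphere u ->
  radial (complex_Lp_intersection_body C p K) u = Ip_radial C p K u.
Proof.
move=> su; have r0 : 0 <= Ip_radial C p K u by exact: powR_ge0.
rewrite /radial [X in sup X](_ : _ = `[0, Ip_radial C p K u]%classic).
  by rewrite sup_itvcc.
apply/seteqP; split => l /=; rewrite in_itv/=; last first.
  by move=> /[dup] lr /andP[l0 _]; split => //; exists u, l.
move=> [l0 [v [m [sv /andP[m0 mr] luv]]]].
have lm : l = m.
  by have := congr1 enorm luv; rewrite !enormZ// su sv !mulr1.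
have [le0|ln0] := eqVneq m 0; first by rewrite lm le0 lexx r0.
suff uv : u = v by rewrite l0/= lm uv.
have := congr1 (GRing.scale m^-1) luv.
by rewrite lm !scalerA mulVf// !scale1r.
Qed.

(* [complex_Lp_intersection_body] is the set with the prescribed radial function:
   the next two lemmas relate it to the defining formula
   rho(u)^(-p) = \int_K h_(Cu)(x)^p dx, and show that it is the only star body
   satisfying that formula. *)
Lemma radial_complex_Lp_intersection_body C (p : R) K u :
  p != 0 -> sphere u -> (0 < support_integral C p K u < +oo)%E ->
  (radial (complex_Lp_intersection_body C p K) u `^ (- p))%:E =
  support_integral C p K u.
Proof.
move=> p0 su /andP[I0 Ioo].
rewrite radial_complex_Lp_intersection_body_Ip// /Ip_radial -powRrM.
rewrite mulrNN mulVf// powRr1 ?fine_ge0 ?ltW// fineK//.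
by rewrite ge0_fin_numE ?ltW.
Qed.

Lemma complex_Lp_intersection_body_unique C (p : R) K L :
  (0 < n)%N -> p != 0 -> star_body L ->
  (forall u, sphere u -> (radial L u `^ (- p))%:E = support_integral C p K u) ->
  L = complex_Lp_intersection_body C p K.
Proof.
move=> n0 p0 [cL sL rL] rE.
have [s0 ss0] : exists u : 'M[R]_(n, 2), sphere u.
  pose i0 := Ordinal n0; exists (delta_mx i0 0).
  rewrite /sphere /= /enorm /dot (bigD1 i0)//= [X in _ + X]big1 ?addr0.
    rewrite (bigD1 0)//= [X in _ + X]big1 ?addr0; first by rewrite mxE !eqxx mulr1 sqrtr1.
    by move=> j /negPf j0; rewrite mxE j0 andbF mul0r.
  by move=> i /negPf ii0; apply: big1 => j _; rewrite mxE ii0 mul0r.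
have rLE u : sphere u -> Ip_radial C p K u = radial L u.
  move=> su; have [r0 _] := rL _ (sphere_neq0 su).
  rewrite /Ip_radial -(rE _ su) /= -powRrM mulrNN divff//.
  by rewrite powRr1// ltW.
have ubL u : u != 0 -> has_ubound [set l : R | 0 <= l /\ L (l *: u)].
  move=> u0; have [M [_ /(_ (M + 1))]] := compact_bounded cL.
  rewrite ltrDl ltr01 => /(_ isT) ML.
  exists ((M + 1) / `|u|) => l /= [l0 /ML].
  by rewrite /= normrZ ger0_norm// ler_pdivlMr ?normr_gt0.
have LP u : sphere u -> L (radial L u *: u).
  move=> su; have u0 := sphere_neq0 su; have [r0 _] := rL _ u0.
  pose S : set R := [set l | 0 <= l] `&` (fun l => l *: u) @^-1` L.
  have cS : closed S.
    apply: closedI; first exact: closed_ge.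
    apply: closed_comp; last exact: compact_closed.
    by move=> l _; exact: scalel_continuous.
  suff : S (radial L u) by case.
  rewrite (iffLR (closure_id S) cS); apply: closure_sup; last exact: ubL.
  apply/set0P/eqP => S0; move: r0; rewrite /radial.
  by rewrite -[X in sup X]/S S0 sup0 ltxx.
apply/seteqP; split => [x Lx|_ [u [l [su /andP[l0 lr] ->]]]]; last first.
  rewrite rLE// in lr; have [r0 _] := rL _ (sphere_neq0 su).
  have := sL _ (l / radial L u) (LP _ su).
  rewrite scalerA divfK ?gt_eqF//; apply.
  by rewrite divr_ge0 ?(ltW r0)//= ler_pdivrMr// mul1r.
have [x0|x0] := eqVneq (enorm x) 0.
  exists s0, 0; split => //; last by rewrite scale0r (enorm_eq0 x0).
  by rewrite lexx powR_ge0.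
have xp : 0 < enorm x by rewrite lt_neqAle eq_sym x0 sqrtr_ge0.
have su : sphere ((enorm x)^-1 *: x).
  by rewrite /sphere /= enormZ ?invr_ge0 ?sqrtr_ge0// mulVf.
exists ((enorm x)^-1 *: x), (enorm x); split => //; last first.
  by rewrite scalerA divff// scale1r.
rewrite rLE// sqrtr_ge0/=; apply: ub_le_sup; first exact/ubL/sphere_neq0.
by split; rewrite ?sqrtr_ge0// scalerA divff// scale1r.
Qed.

End IntersectionBody.

(* Main.v *)
(* Take C = [-e, 1]^2, whose support function is h(x, y) = a(x) + a(y) with
   a(x) = max(x, -e x), and K the unit ball flattened by a factor eta in the
   direction of the imaginary part of the first coordinate. Restricted to the
   complex line of the first coordinate s + i t, the function rho^-p is
   I(u) = \int_K h_(Cu)^p, and K is close to the segment { t = 0 }, so that up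
   to a common factor I(1) and I(i) are close to 1 + e^p, since
   h_(Cu) is large on one half of the segment and small on the other, while I(1 + i)
   is close to 2 (1 + e)^p. If the body were convex, I^(1/p) would be
   subadditive; but 2^(1/p) (1 + e) > 2 (1 + e^p)^(1/p) for small e.
   For 0 < p < 1 the error terms are controlled by the subadditivity of x^p.
   For p < 0 the region |t| > e |s|, where the approximation fails, has to be
   negligible. It contributes O(eta^(p + 2)), and cutting the region |t| <= e |s|
   into dyadic pieces shows that its contribution exceeds eta^(p + 2) by at
   least a factor log(1/eta), even when p = -1. *)
Require Import Defs.
From HB Require Import structures.
From mathcomp Require Import all_boot all_order all_algebra.
From mathcomp Require Import all_classical all_reals all_analysis.
From mathcomp Require Import measurable_realfun ring lra.
Set Implicit Arguments.
Unset Strict Implicit.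
Unset Printing Implicit Defensive.
Import Order.TTheory GRing.Theory Num.Theory.
Import numFieldNormedType.Exports.
Local Open Scope classical_set_scope.
Local Open Scope ring_scope.

(** * Weighted integrals over the plane *)

Section plane.
Context {R : realType}.
Local Notation RR := (measurableTypeR R).
Local Notation mu := (@lebesgue_measure R).

Implicit Types (f g w : R * R -> R).

Definition wint (w f : R * R -> R) : \bar R :=
  (\int[mu \x mu]_z (f z * w z)%:E)%E.

(* [lebesgue_measure] lives on [measurableTypeR R], whose measurable structure
   carries another display than the canonical one of [R]. *)
Lemma measurable_fst_real : measurable_fun [set: RR * RR] (fun z : RR * RR => z.1 : R).
Proof. exact: measurable_fst. Qed.
Lemma measurable_snd_real : measurable_fun [set: RR * RR] (fun z : RR * RR => z.2 : R).
Proof. exact: measurable_snd. Qed.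

Lemma integral_opp (h : R -> \bar R) : measurable_fun [set: RR] h ->
  (forall x, 0 <= h x)%E ->
  (\int[mu]_x h (- x)%R = \int[mu]_x h x)%E.
Proof.
move=> mh h0.
have -> : (\int[mu]_x h x = \int[pushforward mu (-%R : R -> measurableTypeR R)]_x h x)%E.
  by apply: eq_measure_integral => A mA _; exact/esym/lebesgue_measureN.
by rewrite ge0_integral_pushforward.
Qed.

Variable w : R * R -> R.
Hypothesis mw : measurable_fun [set: RR * RR] w.
Hypothesis w0 : forall z, 0 <= w z.

Lemma wint_ge0 f : (forall z, 0 <= f z) -> (0 <= wint w f)%E.
Proof. by move=> f0; apply: integral_ge0 => z _; rewrite lee_fin mulr_ge0. Qed.

(** Comparison on the support of [w] is enough, since both integrands vanish elsewhere; the kernel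
    bounds below hold only on the slab carrying the weight. *)
Lemma le_wint f g : measurable_fun [set: RR * RR] f -> measurable_fun [set: RR * RR] g ->
  (forall z, 0 <= f z) -> (forall z, w z != 0 -> f z <= g z) ->
  (wint w f <= wint w g)%E.
Proof.
move=> mf mg f0 fg; apply: ge0_le_integral => //=.
- by move=> z _; rewrite lee_fin mulr_ge0.
- exact/measurable_EFinP/measurable_funM.
- exact/measurable_EFinP/measurable_funM.
move=> z _; rewrite lee_fin; have [->|wz] := eqVneq (w z) 0; first by rewrite !mulr0.
by rewrite ler_wpM2r// fg.
Qed.

Lemma wintD f g : measurable_fun [set: RR * RR] f -> measurable_fun [set: RR * RR] g ->
  (forall z, 0 <= f z) -> (forall z, 0 <= g z) ->
  wint w (f \+ g) = (wint w f + wint w g)%E.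
Proof.
move=> mf mg f0 g0; rewrite /wint -ge0_integralD//=.
- by apply: eq_integral => z _; rewrite -EFinD mulrDl.
- by move=> z _; rewrite lee_fin mulr_ge0.
- exact/measurable_EFinP/measurable_funM.
- by move=> z _; rewrite lee_fin mulr_ge0.
- exact/measurable_EFinP/measurable_funM.
Qed.

Lemma wintZ k f : measurable_fun [set: RR * RR] f ->
  (forall z, 0 <= f z) -> 0 <= k ->
  wint w (fun z => k * f z) = (k%:E * wint w f)%E.
Proof.
move=> mf f0 k0; rewrite /wint -ge0_integralZl_EFin//=.
- by apply: eq_integral => z _; rewrite -EFinM mulrA.
- by move=> z _; rewrite lee_fin mulr_ge0.
- exact/measurable_EFinP/measurable_funM.
Qed.

(** Tonelli with [z.1] as the inner variable, followed by reflection on the line. It exchanges the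
    two halves of the plane when the weight is even in [z.1]. *)
Lemma wint_opp f : measurable_fun [set: RR * RR] f -> (forall z, 0 <= f z) ->
  (forall s t, w (- s, t) = w (s, t)) ->
  wint w (fun z => f (- z.1, z.2)) = wint w f.
Proof.
move=> mf f0 we; rewrite /wint.
have mfw : measurable_fun [set: RR * RR] (fun z => (f z * w z)%:E).
  exact/measurable_EFinP/measurable_funM.
have fw0 z : (0 <= (f z * w z)%:E)%E by rewrite lee_fin mulr_ge0.
have mn : measurable_fun [set: RR * RR] (fun z : RR * RR => (- z.1, z.2) : RR * RR).
  apply: measurable_fun_pair; last exact: measurable_snd.
  exact: (measurableT_comp (@oppr_measurable R setT) measurable_fst).
have mfn : measurable_fun [set: RR * RR] (fun z => (f (- z.1, z.2) * w z)%:E).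
  apply/measurable_EFinP/measurable_funM => //.
  exact: measurableT_comp mf mn.
rewrite (fubini_tonelli2 _ mfn); last by move=> z; rewrite lee_fin mulr_ge0.
rewrite [RHS](fubini_tonelli2 _ mfw fw0).
apply: eq_integral => y _ /=.
rewrite /fubini_G -(integral_opp (h := fun x : R => (f (x, y) * w (x, y))%:E))//.
  by apply: eq_integral => x _; rewrite we.
exact: measurableT_comp mfw _.
Qed.

End plane.

(** A named constant instead of a bare coercion, so that [measR] can recognize indicators
    syntactically. *)
Definition boolR {R : realType} (b : bool) : R := b%:R.

Lemma measurable_fun_boolR {R : realType} d (T : measurableType d) (b : T -> bool) :
  measurable_fun [set: T] b -> measurable_fun [set: T] (fun x => boolR (b x) : R).
Proof.
move=> mb; rewrite /boolR (_ : (fun _ => _) = (fun x => if b x then 1 else 0)).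
  exact: measurable_fun_ifT.
by apply/funext => x; case: (b x).
Qed.

Lemma boolRE {R : realType} : (boolR true = 1 :> R) * (boolR false = 0 :> R).
Proof. by []. Qed.

(** * Integrals on the line *)

Section line.
Context {R : realType}.
Local Notation mu := (@lebesgue_measure R).

Lemma integral_segment_indic (k m : R) : 0 <= m ->
  (\int[mu]_x (k * boolR (`|x| <= m))%:E = (k * (2 * m))%:E)%E.
Proof.
move=> m0.
have -> : (\int[mu]_x (k * boolR (`|x| <= m))%:E = \int[mu]_(x in `[(- m)%R, m]) k%:E)%E.
  rewrite [RHS]integral_mkcond; apply: eq_integral => x _.
  rewrite patchE mem_setE in_itv/= -ler_norml.
  by case: ifPn => _; rewrite boolRE ?mulr1 ?mulr0.
rewrite integral_cst//= lebesgue_measure_itv/= lte_fin.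
case: ltP => [_|]; first by rewrite -EFinB -EFinM opprK mulr_natl mulr2n.
move=> mm; have -> : m = 0 by lra.
by rewrite mule0 !mulr0.
Qed.

(* For [p = -1] every dyadic interval contributes at least [1 / 2], so that the
   lower bound diverges as [N] grows. *)
Lemma integral_powR_dyadic (p : R) (N : nat) : -1 <= p ->
  ((N%:R / 2 * (2^-1 ^+ N.+1) `^ (p + 1))%:E <=
   \int[mu]_(x in `](2^-1 ^+ N.+1)%R, 2^-1%R]) (x `^ p)%:E)%E.
Proof.
move=> p1; elim: N => [|N IH].
  by rewrite !mul0r; apply: integral_ge0 => x _; rewrite lee_fin powR_ge0.
set b : R := 2^-1 ^+ N.+1; set b' : R := 2^-1 ^+ N.+2.
have b'E : b' = b / 2 by rewrite /b' exprSr.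
have b0 : 0 < b by rewrite exprn_gt0.
have b'b : b' <= b by rewrite b'E; lra.
have bh : b <= 2^-1 by rewrite /b exprS; apply: ler_piMr => //; apply: exprn_ile1 => //; lra.
have -> : `]b', 2^-1]%classic = `]b', b]%classic `|` `]b, 2^-1]%classic :> set R.
  by rewrite -itv_bndbnd_setU ?bnd_simp.
have mp : measurable_fun [set: R] (fun x : R => (x `^ p)%:E).
  by apply/measurable_EFinP; exact: measurable_powR.
rewrite ge0_integral_setU//=; last first.
  - by apply/disj_setPS => x [/=]; rewrite !in_itv/= => /andP[_ xb] /andP[bx _]; lra.
  - by move=> x _; rewrite lee_fin powR_ge0.
  - exact: measurable_funTS.
have b'0 : 0 < b' by rewrite b'E; lra.
(* Writing x^p as x^(p + 1) / x separates a nondecreasing factor, as p + 1 >= 0, from a decreasing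
   one. *)
have hx (x : R) : b' < x -> x <= b -> b' `^ (p + 1) / b <= x `^ p.
  move=> b'x xb; have x0 : 0 < x := lt_trans b'0 b'x.
  rewrite (_ : x `^ p = x `^ (p + 1) / x); last first.
    rewrite -[X in _ / X](powRr1 (ltW x0)) -powRB ?addrK//.
    by rewrite (gt_eqF x0) implybT.
  apply: ler_pM; [exact: powR_ge0|by rewrite invr_ge0 ltW| |].
    by apply: ge0_ler_powR; rewrite ?nnegrE; lra.
  by rewrite lef_pV2 ?posrE.
(* The new interval has length b / 2, which cancels the factor 1 / b and leaves the constant 1 /
   2. *)
have h1 : ((2^-1 * b' `^ (p + 1))%:E <= \int[mu]_(x in `]b', b]) (x `^ p)%:E)%E.
  apply: (@le_trans _ _ (\int[mu]_(x in `]b', b]) (b' `^ (p + 1) / b)%:E)%E).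
    rewrite integral_cst//= lebesgue_measure_itv/= lte_fin.
    rewrite (_ : (b' < b) = true); last by rewrite b'E; lra.
    rewrite -EFinB -EFinM lee_fin b'E.
    rewrite (_ : _ * (b - b / 2) = 2^-1 * (b / 2) `^ (p + 1)) //.
    by field; rewrite gt_eqF.
  apply: ge0_le_integral => //=.
  - by move=> x _; rewrite lee_fin divr_ge0 ?powR_ge0// ltW.
  - exact: measurable_funTS.
  by move=> x; rewrite in_itv/= => /andP[b'x xb]; rewrite lee_fin hx.
apply: le_trans (leeD h1 IH); rewrite -EFinD lee_fin -/b.
(* The induction hypothesis carries the larger factor b^(p + 1), so it may be lowered to that of
   [b']. *)
have : b' `^ (p + 1) <= b `^ (p + 1).
  by apply: ge0_ler_powR; rewrite ?nnegrE; lra.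
move=> bb; rewrite -natr1 mulrDl mulrDl addrC div1r lerD2l.
by apply: ler_wpM2l => //; rewrite divr_ge0.
Qed.

End line.

Ltac measR := repeat lazymatch goal with
  | |- measurable_fun _ (fun _ => ?c) => exact: measurable_cst
  | |- measurable_fun _ (fun z => z) => exact: measurable_id
  | |- measurable_fun _ (fun z => z.1) => exact: measurable_fst_real
  | |- measurable_fun _ (fun z => z.2) => exact: measurable_snd_real
  | |- measurable_fun _ (fun z => boolR (@?b z)) => apply: measurable_fun_boolR
  | |- measurable_fun _ (fun z => @?f z <= @?g z) => apply: measurable_fun_ler
  | |- measurable_fun _ (fun z => @?f z < @?g z) => apply: measurable_fun_ltr
  | |- measurable_fun _ (fun z => Num.max (@?f z) (@?g z)) => apply: measurable_maxr
  | |- measurable_fun _ (fun z => @?f z * @?g z) => apply: measurable_funM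
  | |- measurable_fun _ (fun z => @?f z + @?g z) => apply: measurable_funD
  | |- measurable_fun _ (fun z => - @?f z) =>
      apply: (measurableT_comp (@oppr_measurable _ setT))
  | |- measurable_fun _ (fun z => `|@?f z|) =>
      apply: (measurableT_comp (@normr_measurable _ setT))
  | |- measurable_fun _ (fun z => @?f z `^ _) =>
      apply: (measurableT_comp (@measurable_powR _ _))
  | |- measurable_fun _ Num.Def.normr => exact: normr_measurable
  | |- _ => first [exact: measurable_fst_real | exact: measurable_snd_real | assumption]
  end.

(** * Densities concentrated on a thin slab *)

Section slab.
Context {R : realType}.
Local Notation RR := (measurableTypeR R).
Local Notation mu := (@lebesgue_measure R).
Implicit Types (f g w : R * R -> R).

Lemma boolR_ge0 b : 0 <= boolR b :> R.
Proof. exact: ler0n. Qed.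

(** The inner integral produces the factor 2 k |x|, which raises the exponent to p + 1 >= 0: the
    singularity disappears and the integrand is at most its value at [b]. *)
Lemma wedge_integral (p k b : R) : -1 <= p -> 0 <= k -> 0 <= b ->
  (\int[mu]_x \int[mu]_y
    ((`|x| `^ p * boolR (`|x| <= b)) * boolR (`|y| <= k * `|x|))%:E <=
  (4 * k * b `^ (p + 1) * b)%:E)%E.
Proof.
move=> p1 k0 b0.
apply: (@le_trans _ _ (\int[mu]_x ((2 * k * b `^ (p + 1)) * boolR (`|x| <= b))%:E)%E); last first.
  rewrite integral_segment_indic// lee_fin.
  by rewrite [leLHS](_ : _ = 4 * k * b `^ (p + 1) * b)//; ring.
under eq_integral do rewrite integral_segment_indic ?mulr_ge0//.
apply: ge0_le_integral => //=.
- by move=> x _; rewrite lee_fin mulr_ge0 ?mulr_ge0 ?powR_ge0 ?boolR_ge0 ?mulr_ge0.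
- apply/measurable_EFinP; measR.
- apply/measurable_EFinP; measR.
move=> x _; rewrite lee_fin.
have H (y : R) : `|y| `^ p * boolR (`|y| <= b) * (2 * (k * `|y|))
   <= 2 * k * b `^ (p + 1) * boolR (`|y| <= b).
  case: (leP `|y| b) => yb; rewrite boolRE ?mulr0 ?mul0r// !mulr1.
  have [->|y0] := eqVneq `|y| 0; first by rewrite !mulr0 !mulr_ge0 ?powR_ge0.
  rewrite mulrC -!mulrA ler_wpM2l// ler_wpM2l//.
  rewrite -{1}(powRr1 (normr_ge0 y)) -powRD ?y0 ?implybT// addrC.
  by apply: ge0_ler_powR; rewrite ?nnegrE//; lra.
exact: H.
Qed.

(* Shared by the densities, for small [eta], of the projections onto the first
   complex coordinate of the flattened balls. *)
Definition slab_density (A c eta : R) w : Prop :=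
  [/\ measurable_fun [set: RR * RR] w,
      forall z, 0 <= w z <= A * (boolR (`|z.1| <= 1) * boolR (`|z.2| <= eta)),
      forall s t, w (- s, t) = w (s, t) &
      forall z, `|z.1| <= 2^-1 -> `|z.2| <= eta / 2 -> c <= w z].

Section bounds.
Variables (A c eta : R) (w : R * R -> R).
Hypothesis A0 : 0 <= A.
Hypothesis c0 : 0 <= c.
Hypothesis eta0 : 0 <= eta.
Hypothesis ws : slab_density A c eta w.

Let mw : measurable_fun [set: RR * RR] w. Proof. by case: ws. Qed.
Let w0 z : 0 <= w z. Proof. by case: ws => _ /(_ z)/andP[]. Qed.
Let wA z : w z <= A * (boolR (`|z.1| <= 1) * boolR (`|z.2| <= eta)).
Proof. by case: ws => _ /(_ z)/andP[]. Qed.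

Lemma slab_supp z : w z != 0 -> `|z.1| <= 1 /\ `|z.2| <= eta.
Proof.
move=> wz; have := wA z; rewrite ?boolRE.
have wp : 0 < w z by rewrite lt_neqAle eq_sym wz w0.
case: (leP `|z.1| 1) => z1; case: (leP `|z.2| eta) => z2 //; rewrite !boolRE ?(mulr0, mul0r) => h;
  by have := lt_le_trans wp h; rewrite ltxx.
Qed.

Lemma wint_mass_le : (wint w (fun=> 1%R) <= (A * 4 * eta)%:E)%E.
Proof.
have m : measurable_fun [set: RR * RR]
    (fun z : RR * RR => (A * boolR (`|z.1 : R| <= 1) * boolR (`|z.2 : R| <= eta))%:E).
  by apply/measurable_EFinP; measR.
have nn (z : RR * RR) :
    (0 <= (A * boolR (`|z.1 : R| <= 1) * boolR (`|z.2 : R| <= eta))%:E)%E.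
  by rewrite lee_fin !mulr_ge0 ?boolR_ge0.
rewrite /wint.
apply: (@le_trans _ _ (\int[mu \x mu]_z
   (A * boolR (`|z.1 : R| <= 1) * boolR (`|z.2 : R| <= eta))%:E)%E).
  apply: ge0_le_integral => //=.
  - by move=> z _; rewrite mul1r lee_fin.
  - by apply/measurable_EFinP; under eq_fun do rewrite mul1r.
  - by move=> z _; rewrite mul1r lee_fin -mulrA.
rewrite fubini_tonelli1// /fubini_F/=.
under eq_integral do rewrite integral_segment_indic//.
rewrite [X in (X <= _)%E](_ : _ =
    \int[mu]_x (A * (2 * eta) * boolR (`|x : R| <= 1))%:E)%E.
  by rewrite integral_segment_indic// lee_fin; lra.
by apply: eq_integral => x _; rewrite mulrAC.
Qed.

(** The bound does not see the thickness [eta]; it serves to prove that wedge integrals are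
    finite. *)
Lemma wint_wedge_le (p k : R) : -1 <= p -> 0 <= k ->
  (wint w (fun z => `|z.1| `^ p * boolR (`|z.2| <= k * `|z.1|))%R <= (A * (4 * k))%:E)%E.
Proof.
move=> p1 k0.
have m : measurable_fun [set: RR * RR]
    (fun z : RR * RR => (`|z.1 : R| `^ p * boolR (`|z.1 : R| <= 1) * boolR (`|z.2 : R| <= k * `|z.1 : R|))%:E).
  by apply/measurable_EFinP; measR.
have nn (z : RR * RR) :
    (0 <= (`|z.1 : R| `^ p * boolR (`|z.1 : R| <= 1) * boolR (`|z.2 : R| <= k * `|z.1 : R|))%:E)%E.
  by rewrite lee_fin !mulr_ge0 ?boolR_ge0 ?powR_ge0.
rewrite /wint.
apply: (@le_trans _ _ (\int[mu \x mu]_z (A%:E *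
   (`|z.1 : R| `^ p * boolR (`|z.1 : R| <= 1) * boolR (`|z.2 : R| <= k * `|z.1 : R|))%:E))%E).
  apply: ge0_le_integral => //=.
  - by move=> z _; rewrite lee_fin !mulr_ge0 ?boolR_ge0 ?powR_ge0.
  - by apply/measurable_EFinP; measR.
  - by apply/measurable_EFinP; measR.
  move=> z _; rewrite -EFinM lee_fin.
  apply: (le_trans (ler_wpM2l _ (wA z))); first by rewrite mulr_ge0 ?boolR_ge0 ?powR_ge0.
  case: (`|z.1| <= 1); case: (`|z.2| <= eta);
    case: (`|z.2| <= k * `|z.1|); rewrite !boolRE ?(mulr1, mulr0, mul0r) ?mulr_ge0 ?powR_ge0//.
  by rewrite mulrC.
rewrite ge0_integralZl_EFin// EFinM lee_wpmul2l//.
rewrite fubini_tonelli1// /fubini_F/=.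
apply: le_trans (wedge_integral p1 k0 ler01) _.
by rewrite powR1 !mulr1 lee_fin.
Qed.

(* Integrating first in [z.1] avoids the singularity at the origin. *)
Lemma wint_cowedge_le (p k : R) : -1 <= p -> 0 <= k ->
  (wint w (fun z => `|z.2| `^ p * boolR (`|z.1| <= k * `|z.2|))%R
   <= (A * (4 * k * eta `^ (p + 1) * eta))%:E)%E.
Proof.
move=> p1 k0.
have m : measurable_fun [set: RR * RR]
    (fun z : RR * RR => (`|z.2 : R| `^ p * boolR (`|z.2 : R| <= eta) * boolR (`|z.1 : R| <= k * `|z.2 : R|))%:E).
  by apply/measurable_EFinP; measR.
have nn (z : RR * RR) :
    (0 <= (`|z.2 : R| `^ p * boolR (`|z.2 : R| <= eta) * boolR (`|z.1 : R| <= k * `|z.2 : R|))%:E)%E.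
  by rewrite lee_fin !mulr_ge0 ?boolR_ge0 ?powR_ge0.
rewrite /wint.
apply: (@le_trans _ _ (\int[mu \x mu]_z (A%:E *
   (`|z.2 : R| `^ p * boolR (`|z.2 : R| <= eta) * boolR (`|z.1 : R| <= k * `|z.2 : R|))%:E))%E).
  apply: ge0_le_integral => //=.
  - by move=> z _; rewrite lee_fin !mulr_ge0 ?boolR_ge0 ?powR_ge0.
  - by apply/measurable_EFinP; measR.
  - by apply/measurable_EFinP; measR.
  move=> z _; rewrite -EFinM lee_fin.
  apply: (le_trans (ler_wpM2l _ (wA z))); first by rewrite mulr_ge0 ?boolR_ge0 ?powR_ge0.
  case: (`|z.1| <= 1); case: (`|z.2| <= eta);
    case: (`|z.1| <= k * `|z.2|); rewrite !boolRE ?(mulr1, mulr0, mul0r) ?mulr_ge0 ?powR_ge0//.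
  by rewrite mulrC.
rewrite ge0_integralZl_EFin// EFinM lee_wpmul2l//.
rewrite fubini_tonelli2// /fubini_G/=.
exact: wedge_integral.
Qed.

(** On the rectangle the weight is at least [c] and the fibres in [z.2] have length [eta], which
    leaves the dyadic integral on the line. For p > 0 the case N = 1 is enough; for p < 0 a large
    [N] beats the error. *)
Lemma wint_dyadic_ge (p : R) (N : nat) f : -1 <= p ->
  measurable_fun [set: RR * RR] f -> (forall z, 0 <= f z) ->
  (forall z, 2^-1 ^+ N.+1 < z.1 <= 2^-1 -> `|z.2| <= eta / 2 -> z.1 `^ p <= f z) ->
  ((c * eta * (N%:R / 2 * (2^-1 ^+ N.+1) `^ (p + 1)))%:E <= wint w f)%E.
Proof.
move=> p1 mf f0 fp; set b : R := 2^-1 ^+ N.+1.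
have b0 : 0 <= b by rewrite exprn_ge0.
pose I (x : R) := (b < x) && (x <= 2^-1).
have m : measurable_fun [set: RR * RR]
    (fun z : RR * RR => (c * ((z.1 : R) `^ p * boolR (I z.1)) * boolR (`|z.2 : R| <= eta / 2))%:E).
  apply/measurable_EFinP; measR.
  by apply: measurable_and; measR.
have nn (z : RR * RR) :
    (0 <= (c * ((z.1 : R) `^ p * boolR (I z.1)) * boolR (`|z.2 : R| <= eta / 2))%:E)%E.
  by rewrite lee_fin !mulr_ge0 ?boolR_ge0 ?powR_ge0.
apply: (@le_trans _ _ (\int[mu \x mu]_z (c * ((z.1 : R) `^ p * boolR (I z.1)) * boolR (`|z.2 : R| <= eta / 2))%:E)%E); last first.
  apply: ge0_le_integral => //=.
  - by apply/measurable_EFinP; measR.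
  move=> z _; rewrite lee_fin.
  case: (boolP (I z.1)) => Iz; last by rewrite boolRE !(mulr0, mul0r) mulr_ge0.
  case: (leP `|z.2| (eta / 2)) => z2; last by rewrite !boolRE !(mulr0, mul0r) mulr_ge0.
  rewrite !boolRE !mulr1 mulrC ler_pM ?powR_ge0 ?fp//.
  have [_ _ _] := ws; apply => //.
  by move: Iz => /andP[bz zh]; rewrite ger0_norm// (le_trans b0 (ltW bz)).
rewrite fubini_tonelli1// /fubini_F/=.
under eq_integral do rewrite integral_segment_indic ?divr_ge0//.
rewrite [X in (_ <= X)%E](_ : _ = (c * eta)%:E * \int[mu]_(x in `]b, 2^-1%R]) (x `^ p)%:E)%E.
  rewrite EFinM lee_wpmul2l ?lee_fin ?mulr_ge0//.
  exact: integral_powR_dyadic.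
rewrite [in RHS]integral_mkcond -ge0_integralZl_EFin ?mulr_ge0//.
- apply: eq_integral => x _; rewrite patchE mem_setE in_itv/= -/(I x).
  case: (I x); rewrite boolRE; last by rewrite !(mulr0, mul0r) mule0.
  by rewrite -EFinM mulr1 -mulr_natr -!mulrA; congr (_ * _)%:E; field.
- by move=> x _; rewrite patchE; case: ifP => // _; rewrite lee_fin powR_ge0.
- apply/(measurable_restrictT _ _).1 => //.
  by apply/measurable_EFinP/measurable_funTS; exact: measurable_powR.
Qed.

End bounds.
End slab.

(** * The planar inequality for positive exponents *)

Section powR.
Context {R : realType}.
Implicit Types x y p : R.

(** For z = x and z = y the ratio z / (x + y) lies in [0, 1], hence is at most its own p-th power;
    the two ratios add up to 1. *)
Lemma powR_subadditive p x y : 0 <= p <= 1 -> 0 <= x -> 0 <= y ->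
  (x + y) `^ p <= x `^ p + y `^ p.
Proof.
move=> /andP[p0 p1] x0 y0.
have [xy0|xy0] := eqVneq (x + y) 0.
  have -> : x = 0 by lra.
  by rewrite add0r lerDr powR_ge0.
have xyp : 0 < x + y by rewrite lt_neqAle eq_sym xy0 addr_ge0.
have key z : 0 <= z -> z <= x + y -> z / (x + y) * (x + y) `^ p <= z `^ p.
  move=> z0 zxy; have [->|zn0] := eqVneq z 0; first by rewrite !mul0r powR_ge0.
  have zp : 0 < z by rewrite lt_neqAle eq_sym zn0.
  rewrite -[in leRHS](divfK xy0 z) powRM ?divr_ge0 ?addr_ge0//.
  by rewrite ler_wpM2r ?powR_ge0// ger1_powR ?divr_gt0//= ler_pdivrMr// mul1r.
have := lerD (key x x0 _) (key y y0 _).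
by rewrite -!mulrDl divff// mul1r; apply; lra.
Qed.

(** The smaller argument has to be positive: for p < 0 the convention 0^p = 0 breaks monotonicity at
    the origin. *)
Lemma le_powR_neg p x y : p <= 0 -> 0 < x -> x <= y -> y `^ p <= x `^ p.
Proof.
move=> p0 x0 xy; rewrite -[p]opprK powRN [leRHS]powRN lef_pV2 ?posrE.
- by apply: ge0_ler_powR; rewrite ?nnegrE; lra.
- by rewrite powR_gt0//; lra.
- by rewrite powR_gt0.
Qed.

Lemma lt_powR_neg p x y : p < 0 -> 0 < x -> x < y -> y `^ p < x `^ p.
Proof.
move=> p0 x0 xy; rewrite -[p]opprK powRN [ltRHS]powRN ltf_pV2 ?posrE.
- by apply: gt0_ltr_powR; rewrite ?nnegrE; lra.
- by rewrite powR_gt0//; lra.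
- by rewrite powR_gt0.
Qed.

Lemma powRVK p x : p != 0 -> 0 <= x -> (x `^ p^-1) `^ p = x.
Proof. by move=> p0 x0; rewrite -powRrM mulVf// powRr1. Qed.

End powR.

(** * The kernel of the square *)

Section kernel.
Context {R : realType}.
Local Notation RR := (measurableTypeR R).

(* The support function of the interval [-e, 1]. *)
Definition asym (e x : R) : R := Num.max x (- (e * x)).

(* [h_(Cu)(x) ^ p] for [C] the square [-e, 1]^2, [u = a0 + i a1] and
   [x = z.1 + i z.2]. *)
Definition square_kernel (e p a0 a1 : R) (z : R * R) : R :=
  (asym e (z.1 * a0 + z.2 * a1) + asym e (z.2 * a0 - z.1 * a1)) `^ p.

Lemma asym_ge (e x : R) : 0 < e <= 1 -> e * `|x| <= asym e x.
Proof.
move=> /andP[e0 e1]; rewrite /asym le_max.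
have [x0|x0] := leP 0 x; apply/orP; [left|right].
  by rewrite ger0_norm// ler_piMl.
by rewrite ltr0_norm// mulrN.
Qed.

Lemma asym_le (e x : R) : 0 < e <= 1 -> asym e x <= `|x|.
Proof.
move=> /andP[e0 e1]; rewrite /asym ge_max ler_norm/=.
by have [x0|x0] := leP 0 x; [rewrite ger0_norm//|rewrite ltr0_norm//]; nra.
Qed.

Lemma asym_ge0 (e x : R) : 0 < e <= 1 -> 0 <= asym e x.
Proof. by move=> he; apply: le_trans (asym_ge x he); rewrite mulr_ge0//; lra. Qed.

Lemma ge_asym (e x : R) : x <= asym e x.
Proof. by rewrite /asym le_max lexx. Qed.

Lemma asym_pos (e x : R) : 0 < e -> 0 <= x -> asym e x = x.
Proof. by move=> e0 x0; apply/max_idPl; nra. Qed.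

Lemma asym_neg (e x : R) : 0 < e -> x <= 0 -> asym e x = e * - x.
Proof. by move=> e0 x0; rewrite mulrN; apply/max_idPr; nra. Qed.

Lemma square_kernel_ge0 (e p a0 a1 : R) z : 0 <= square_kernel e p a0 a1 z.
Proof. exact: powR_ge0. Qed.

Lemma measurable_square_kernel (e p a0 a1 : R) :
  measurable_fun [set: RR * RR] (square_kernel e p a0 a1).
Proof. by rewrite /square_kernel /asym; measR. Qed.

Lemma square_kernel10 (e p : R) z :
  square_kernel e p 1 0 z = (asym e z.1 + asym e z.2) `^ p.
Proof. by rewrite /square_kernel !mulr1 !mulr0 addr0 subr0. Qed.

Lemma square_kernel01 (e p : R) z :
  square_kernel e p 0 1 z = (asym e z.2 + asym e (- z.1)) `^ p.
Proof. by rewrite /square_kernel !mulr1 !mulr0 !add0r. Qed.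

Lemma square_kernel11 (e p : R) z :
  square_kernel e p 1 1 z = (asym e (z.1 + z.2) + asym e (z.2 - z.1)) `^ p.
Proof. by rewrite /square_kernel !mulr1. Qed.

(** The convention 0^p = 0 kills the part of the wrong sign, for negative exponents too. *)
Lemma powR_max0_sum (p x : R) : p != 0 ->
  Num.max x 0 `^ p + Num.max (- x) 0 `^ p = `|x| `^ p.
Proof.
move=> p0; have [x0|x0] := leP 0 x.
  by rewrite [Num.max (- x) 0]max_r ?oppr_le0// powR0// addr0 ger0_norm.
by rewrite powR0// add0r max_l ?ltr0_norm// oppr_ge0 ltW.
Qed.

(** The map x^(-1/p) is decreasing and sends 2^p S to sigma / 2. With i1, i2, i3 the integrals at 1,
    i and 1 + i, the conclusion says that the midpoint of sigma and sigma i is outside the body. *)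
Lemma powR_gap_pos (p S i1 i2 i3 : R) : 0 < p ->
  0 < i1 <= S -> 0 < i2 <= S -> 2 `^ p * S < i3 ->
  let sigma := S `^ (- p^-1) in
  [/\ 0 < sigma, sigma <= i1 `^ (- p^-1) /\ sigma <= i2 `^ (- p^-1) &
      i3 `^ (- p^-1) < sigma / 2].
Proof.
move=> p0 /andP[i10 i1S] /andP[i20 i2S] i3S.
have S0 : 0 < S by lra.
have q0 : - p^-1 < 0 by rewrite oppr_lt0 invr_gt0.
split; first exact: powR_gt0.
  by split; apply: le_powR_neg => //; exact: ltW.
have -> : S `^ (- p^-1) / 2 = (2 `^ p * S) `^ (- p^-1).
  rewrite powRM ?powR_ge0 ?ltW// -powRrM mulrN divff ?gt_eqF//.
  by rewrite powR_inv1// mulrC.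
by apply: lt_powR_neg => //; rewrite mulr_gt0// powR_gt0.
Qed.

(** For p < 0 the map x^(-1/p) is increasing, so all comparisons between integrals are reversed. *)
Lemma powR_gap_neg (p S i1 i2 i3 : R) : p < 0 ->
  0 < S -> S <= i1 -> S <= i2 -> 0 <= i3 < 2 `^ p * S ->
  let sigma := S `^ (- p^-1) in
  [/\ 0 < sigma, sigma <= i1 `^ (- p^-1) /\ sigma <= i2 `^ (- p^-1) &
      i3 `^ (- p^-1) < sigma / 2].
Proof.
move=> p0 S0 i1S i2S /andP[i30 i3S].
have q0 : 0 < - p^-1 by rewrite oppr_gt0 invr_lt0.
split; first exact: powR_gt0.
  by split; apply: ge0_ler_powR; rewrite ?nnegrE; lra.
have -> : S `^ (- p^-1) / 2 = (2 `^ p * S) `^ (- p^-1).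
  rewrite powRM ?powR_ge0 ?(ltW S0)// -powRrM mulrN divff ?lt_eqF//.
  by rewrite powR_inv1// mulrC.
by apply: gt0_ltr_powR; rewrite ?nnegrE ?mulr_ge0 ?powR_ge0 ?(ltW S0).
Qed.

(** For p > 0 this and [neg_part_powR] are the limits of the kernels at 1 and i on the line z.2 = 0
    as [e] tends to 0; their sum is the limit at 1 + i. *)
Definition pos_part_powR (p : R) (z : R * R) : R := Num.max z.1 0 `^ p.
Definition neg_part_powR (p : R) (z : R * R) : R := Num.max (- z.1) 0 `^ p.

Lemma pos_part_powR_ge0 (p : R) z : 0 <= pos_part_powR p z.
Proof. exact: powR_ge0. Qed.

Lemma neg_part_powR_ge0 (p : R) z : 0 <= neg_part_powR p z.
Proof. exact: powR_ge0. Qed.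

Lemma measurable_pos_part_powR (p : R) :
  measurable_fun [set: RR * RR] (pos_part_powR p).
Proof. by rewrite /pos_part_powR; measR. Qed.

Lemma measurable_neg_part_powR (p : R) :
  measurable_fun [set: RR * RR] (neg_part_powR p).
Proof. by rewrite /neg_part_powR; measR. Qed.

(** For positive exponents this is where p < 1 enters: in the limit the integral at 1 + i is twice
    the one at 1, and 2 > 2^p. *)
Lemma two_powR_lt2 (p : R) : p < 1 -> 2 `^ p < 2.
Proof.
move=> p1; rewrite -[ltRHS](@powRr1 _ 2)// -[X in _ < 2 `^ X](subrK p).
rewrite powRD; last exact/implyP.
rewrite ltr_pMl ?powR_gt0//.
apply: (@le_lt_trans _ _ (1 `^ (1 - p))); first by rewrite powR1.
by apply: gt0_ltr_powR; rewrite ?nnegrE; lra.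
Qed.

Lemma wint_fin (W f : R * R -> R) (x : R) : (forall z, 0 <= W z) ->
  (forall z, 0 <= f z) -> (wint W f <= x%:E)%E -> wint W f \is a fin_num.
Proof.
move=> W0 f0 fx; rewrite ge0_fin_numE; last exact: wint_ge0.
exact: le_lt_trans fx (ltry _).
Qed.

(** * Comparison with the limit kernels, the asymmetry being equal to the thickness *)

Section gap_pos.
Variables (p A c eta : R) (W : R * R -> R).
Hypothesis hp : 0 < p < 1.
Hypothesis A0 : 0 < A.
Hypothesis c0 : 0 < c.
Hypothesis he : 0 < eta <= 1.
Hypothesis ws : slab_density A c eta W.

Let p0 : 0 < p. Proof. by case/andP: hp. Qed.
Let p1 : p < 1. Proof. by case/andP: hp. Qed.
Let pn0 : p != 0. Proof. by rewrite gt_eqF. Qed.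
Let eta0 : 0 < eta. Proof. by case/andP: he. Qed.
Let mW : measurable_fun [set: RR * RR] W. Proof. by case: ws. Qed.
Let W0 z : 0 <= W z. Proof. by case: ws => _ /(_ z)/andP[]. Qed.
(** On the slab the arguments of the powers are off by at most 2 eta, so by subadditivity the powers
    are off by at most [h]. *)
Let h := (2 * eta) `^ p.
Let h0 : 0 <= h. Proof. exact: powR_ge0. Qed.
Let M := wint W (fun=> 1%R).
Let m1 : measurable_fun [set: RR * RR] (fun=> 1 : R).
Proof. exact: measurable_cst. Qed.

(** The pointwise error [h] costs h M. As the mass [M] is O(eta), like the main term, the relative
    error is O(h). *)
Lemma wint_le_add (Q k : R * R -> R) : measurable_fun [set: RR * RR] Q ->
    (forall z, 0 <= Q z) -> measurable_fun [set: RR * RR] k -> (forall z, 0 <= k z) ->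
    (forall z, W z != 0 -> k z <= Q z + h) ->
    (wint W k <= wint W Q + h%:E * M)%E.
Proof.
move=> mQ Q0 mk k0 kQ.
have mh : measurable_fun [set: RR * RR] (fun=> h * 1 : R) by exact: measurable_cst.
rewrite -(wintZ mW W0 m1 (fun=> ler01) h0) -(wintD mW W0 mQ mh Q0); last first.
  by move=> z; rewrite mulr1.
apply: (le_wint mW W0 mk _ k0); first exact: measurable_funD.
by move=> z wz /=; rewrite mulr1 kQ.
Qed.

Lemma wint_neg_part : wint W (neg_part_powR p) = wint W (pos_part_powR p).
Proof.
have [_ _ wsym _] := ws.
by rewrite -(wint_opp mW W0 (measurable_pos_part_powR p) (pos_part_powR_ge0 p) wsym).
Qed.

(** On the slab |z.1| <= 1, so [asym eta z.1] exceeds the positive part of [z.1] by at most [eta],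
    and [asym eta z.2] contributes at most another [eta]. *)
Lemma kernel10_le : (wint W (square_kernel eta p 1 0) <=
  wint W (pos_part_powR p) + h%:E * M)%E.
Proof.
apply: (wint_le_add (measurable_pos_part_powR p) (pos_part_powR_ge0 p)
  (measurable_square_kernel _ _ _ _) (square_kernel_ge0 _ _ _ _)).
move=> z /(slab_supp ws)[z1 z2]; rewrite square_kernel10.
have e2 : 0 <= 2 * eta by rewrite mulr_ge0// ltW.
have m0 : 0 <= Num.max z.1 0 by rewrite le_max lexx orbT.
have p01 : 0 <= p <= 1 by rewrite !ltW.
apply: le_trans (powR_subadditive p01 m0 e2).
apply: ge0_ler_powR; rewrite ?nnegrE ?addr_ge0 ?asym_ge0 ?(ltW p0)//.
have : asym eta z.1 <= Num.max z.1 0 + eta.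
  have [z10|z10] := leP z.1 0.
    rewrite asym_neg//; move: z1; rewrite ler0_norm// => z1; nra.
  by rewrite asym_pos ?(ltW z10)// lerDl ltW.
by have := asym_le z.2 he; lra.
Qed.

Lemma kernel01_le : (wint W (square_kernel eta p 0 1) <=
  wint W (pos_part_powR p) + h%:E * M)%E.
Proof.
rewrite -wint_neg_part.
apply: (wint_le_add (measurable_neg_part_powR p) (neg_part_powR_ge0 p)
  (measurable_square_kernel _ _ _ _) (square_kernel_ge0 _ _ _ _)).
move=> z /(slab_supp ws)[z1 z2]; rewrite square_kernel01.
have e2 : 0 <= 2 * eta by rewrite mulr_ge0// ltW.
have m0 : 0 <= Num.max (- z.1) 0 by rewrite le_max lexx orbT.
have p01 : 0 <= p <= 1 by rewrite !ltW.
apply: le_trans (powR_subadditive p01 m0 e2).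
apply: ge0_ler_powR; rewrite ?nnegrE ?addr_ge0 ?asym_ge0 ?(ltW p0)//.
have : asym eta (- z.1) <= Num.max (- z.1) 0 + eta.
  have [z10|z10] := leP (- z.1) 0.
    rewrite asym_neg//; move: z1; rewrite -normrN ler0_norm// => z1; nra.
  by rewrite asym_pos ?(ltW z10)// lerDl ltW.
by have := asym_le z.2 he; lra.
Qed.

(** Together with [kernel01_ge] this makes the integrals at 1 and i positive, as [powR_gap_pos]
    requires. *)
Lemma kernel10_ge : (wint W (pos_part_powR p) <= wint W (square_kernel eta p 1 0))%E.
Proof.
apply: (le_wint mW W0 (measurable_pos_part_powR p)
  (measurable_square_kernel _ _ _ _) (pos_part_powR_ge0 p)) => z _.
rewrite square_kernel10.
apply: ge0_ler_powR; rewrite ?nnegrE ?addr_ge0 ?asym_ge0 ?le_max ?lexx ?orbT ?(ltW p0)//.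
by rewrite ge_max ?addr_ge0 ?asym_ge0// andbT ler_wpDr ?asym_ge0 ?ge_asym.
Qed.

Lemma kernel01_ge : (wint W (pos_part_powR p) <= wint W (square_kernel eta p 0 1))%E.
Proof.
rewrite -wint_neg_part; apply: (le_wint mW W0 (measurable_neg_part_powR p)
  (measurable_square_kernel _ _ _ _) (neg_part_powR_ge0 p)) => z _.
rewrite square_kernel01.
apply: ge0_ler_powR; rewrite ?nnegrE ?addr_ge0 ?asym_ge0 ?le_max ?lexx ?orbT ?(ltW p0)//.
by rewrite ge_max ?addr_ge0 ?asym_ge0// andbT ler_wpDl ?asym_ge0 ?ge_asym.
Qed.

(** The two limit kernels add up to |z.1|^p, and one of z.1 + z.2 and z.2 - z.1 is at least |z.1| -
    eta. *)
Lemma kernel11_ge : (wint W (pos_part_powR p) + wint W (pos_part_powR p) <=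
  wint W (square_kernel eta p 1 1) + h%:E * M)%E.
Proof.
have := wintD mW W0 (measurable_pos_part_powR p)
  (measurable_neg_part_powR p) (pos_part_powR_ge0 p) (neg_part_powR_ge0 p).
rewrite wint_neg_part => <-.
apply: (wint_le_add (measurable_square_kernel _ _ _ _) (square_kernel_ge0 _ _ _ _)).
- exact: measurable_funD (measurable_pos_part_powR p) (measurable_neg_part_powR p).
- by move=> z; rewrite addr_ge0 ?pos_part_powR_ge0 ?neg_part_powR_ge0.
move=> z /(slab_supp ws)[z1 z2].
rewrite /= /pos_part_powR /neg_part_powR powR_max0_sum// square_kernel11.
have e2 : 0 <= 2 * eta by rewrite mulr_ge0// ltW.
have p01 : 0 <= p <= 1 by rewrite !ltW.
have g1 := ge_asym eta (z.1 + z.2); have g2 := ge_asym eta (z.2 - z.1).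
have q1 := asym_ge0 (z.1 + z.2) he; have q2 := asym_ge0 (z.2 - z.1) he.
apply: le_trans (powR_subadditive p01 (addr_ge0 q1 q2) e2).
apply: ge0_ler_powR; rewrite ?nnegrE ?addr_ge0 ?(ltW p0)//.
move: z2; rewrite ler_norml => /andP[z2 z2'].
by have [z10|z10] := leP 0 z.1; [rewrite ger0_norm//|rewrite ltr0_norm//]; lra.
Qed.

(** Finiteness has to be checked because [fine] sends infinity to 0. On the slab the base of the
    power is at most 2 (1 + eta) <= 4. *)
Lemma kernel11_fin : wint W (square_kernel eta p 1 1) \is a fin_num.
Proof.
have M4 := wint_mass_le (ltW A0) (ltW eta0) ws.
apply: (@wint_fin _ _ (4 `^ p * (A * 4 * eta))) => //; first exact: square_kernel_ge0.
have p4 : 0 <= 4 `^ p by exact: powR_ge0.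
apply: (@le_trans _ _ ((4 `^ p)%:E * M)%E); last by rewrite EFinM lee_wpmul2l.
rewrite -(wintZ mW W0 m1 (fun=> ler01) p4).
apply: (le_wint mW W0 (measurable_square_kernel _ _ _ _) _ (square_kernel_ge0 _ _ _ _)).
  exact: measurable_cst.
move=> z /(slab_supp ws)[z1 z2]; rewrite mulr1 square_kernel11.
apply: ge0_ler_powR; rewrite ?nnegrE ?addr_ge0 ?asym_ge0 ?(ltW p0)//.
have g1 := asym_le (z.1 + z.2) he; have g2 := asym_le (z.2 - z.1) he.
have := ler_normD z.1 z.2; have := ler_normB z.2 z.1.
have : eta <= 1 by case/andP: he.
lra.
Qed.

(** Let P be the integral of [pos_part_powR p]. The hypothesis yields 6 h M <= (2 - 2^p) P, so S = P
    + h M bounds the integrals at 1 and i, while 2^p S < 2 P - h M, a lower bound at 1 + i. *)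
Lemma gap_pos_fixed :
  h * (24 * A) <= (2 - 2 `^ p) * (c / 2 * (2^-1 ^+ 2) `^ (p + 1)) ->
  exists sigma : R,
    [/\ 0 < sigma,
     sigma <= fine (wint W (square_kernel eta p 1 0)) `^ (- p^-1) /\
     sigma <= fine (wint W (square_kernel eta p 0 1)) `^ (- p^-1) &
     fine (wint W (square_kernel eta p 1 1)) `^ (- p^-1) < sigma / 2].
Proof.
set c1 := c / 2 * _ => hc1.
have c10 : 0 < c1 by rewrite mulr_gt0 ?divr_gt0// powR_gt0// exprn_gt0.
have d1 := two_powR_lt2 p1.
(* A single dyadic interval, (1/4, 1/2], gives a lower bound linear in [eta]. *)
have Pj : ((c1 * eta)%:E <= wint W (pos_part_powR p))%E.
  have -> : c1 * eta = c * eta * (1%:R / 2 * (2^-1 ^+ 2) `^ (p + 1)) by rewrite /c1; field.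
  have pm1 : -1 <= p by have := p0; lra.
  apply: (wint_dyadic_ge (ltW c0) (ltW eta0) ws pm1 (measurable_pos_part_powR p)
    (pos_part_powR_ge0 p)).
  move=> z /andP[bz _] _; rewrite /pos_part_powR max_l//.
  by apply: le_trans (ltW bz); rewrite exprn_ge0.
have M4 := wint_mass_le (ltW A0) (ltW eta0) ws.
have M0 : (0 <= M)%E by apply: wint_ge0.
have Mfin := wint_fin W0 (fun=> ler01) M4.
have PM : (wint W (pos_part_powR p) <= M)%E.
  apply: (le_wint mW W0 (measurable_pos_part_powR p) m1 (pos_part_powR_ge0 p)).
  move=> z /(slab_supp ws)[z1 _].
  apply: (@le_trans _ _ (1 `^ p)); last by rewrite powR1.
  apply: ge0_ler_powR; rewrite ?nnegrE ?le_max ?lexx ?orbT ?(ltW p0)//.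
  by rewrite ge_max (le_trans (ler_norm _) z1)/=.
have Pfin := wint_fin W0 (pos_part_powR_ge0 p) (le_trans PM M4).
have finM (X : \bar R) : (0 <= X)%E -> (X <= wint W (pos_part_powR p) + h%:E * M)%E ->
    X \is a fin_num.
  move=> X0 XM; rewrite ge0_fin_numE//; apply: le_lt_trans XM _.
  by rewrite /M -(fineK Pfin) -(fineK Mfin) -EFinM -EFinD ltry.
have f1 := finM _ (wint_ge0 W0 (square_kernel_ge0 _ _ _ _)) kernel10_le.
have f2 := finM _ (wint_ge0 W0 (square_kernel_ge0 _ _ _ _)) kernel01_le.
have f3 := kernel11_fin.
have fE (X : \bar R) : X \is a fin_num -> exists r : R, X = r%:E.
  by move=> fX; exists (fine X); rewrite fineK.
have [i1 i1E] := fE _ f1; have [i2 i2E] := fE _ f2; have [i3 i3E] := fE _ f3.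
have [j jE] := fE _ Pfin; have [m mE] := fE _ Mfin.
have := kernel10_le; have := kernel01_le.
have := kernel10_ge; have := kernel01_ge; have := kernel11_ge.
move: Pj M4 M0; rewrite /M i1E i2E i3E jE mE -!EFinM -!EFinD !lee_fin /=.
move=> Pj M4 M0 l3 l2 l1 u2 u1.
have c1e : 0 < c1 * eta by rewrite mulr_gt0.
exists ((j + h * m) `^ (- p^-1)).
apply: powR_gap_pos => //; try by apply/andP; split; lra.
(* The factor [eta] in the bounds for [m] and [j] cancels; 24 is 6 times the 4 of the mass bound. *)
have hm : h * m * 6 <= (2 - 2 `^ p) * j.
  have : (2 - 2 `^ p) * (c1 * eta) <= (2 - 2 `^ p) * j.
    by rewrite ler_wpM2l// subr_ge0 ltW.
  have : h * m <= h * (A * 4 * eta) by rewrite ler_wpM2l.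
  have : h * (24 * A) * eta <= (2 - 2 `^ p) * c1 * eta by rewrite ler_wpM2r// ltW.
  lra.
have h2 : 2 `^ p * (h * m) <= 2 * (h * m) by rewrite ler_wpM2r ?mulr_ge0// ltW.
have : 0 < (2 - 2 `^ p) * j by rewrite mulr_gt0//; lra.
move: hm h2; rewrite mulrBl mulrDr; lra.
Qed.

End gap_pos.

Lemma square_kernel_gap_pos (p A c : R) (w : R -> R * R -> R) :
  0 < p < 1 -> 0 < A -> 0 < c ->
  (forall eta, 0 < eta -> slab_density A c eta (w eta)) ->
  exists e eta sigma : R,
    [/\ 0 < e <= 1, 0 < eta & [/\ 0 < sigma,
     sigma <= fine (wint (w eta) (square_kernel e p 1 0)) `^ (- p^-1) /\
     sigma <= fine (wint (w eta) (square_kernel e p 0 1)) `^ (- p^-1) &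
     fine (wint (w eta) (square_kernel e p 1 1)) `^ (- p^-1) < sigma / 2]].
Proof.
move=> /[dup] hp /andP[p0 p1] A0 c0 hw.
have pn0 : p != 0 by rewrite gt_eqF.
pose c1 : R := (2 - 2 `^ p) * (c / 2 * (2^-1 ^+ 2) `^ (p + 1)).
have c10 : 0 < c1.
  by rewrite mulr_gt0 ?subr_gt0 ?two_powR_lt2// mulr_gt0 ?divr_gt0// powR_gt0// exprn_gt0.
pose h0 : R := c1 / (24 * A).
have A24 : 0 < 24 * A by rewrite pmulr_rgt0.
have h00 : 0 < h0 by exact: divr_gt0.
(* The first bound is for [eta] in its role as asymmetry [e] <= 1, the second makes (2 eta)^p at
   most [h0]. *)
pose eta : R := Num.min 1 (h0 `^ p^-1 / 2).
have eta0 : 0 < eta by rewrite lt_min ltr01 divr_gt0// powR_gt0.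
have he : 0 < eta <= 1 by rewrite eta0 ge_min lexx.
have hh0 : (2 * eta) `^ p <= h0.
  rewrite -[leRHS](powRVK pn0 (ltW h00)); apply: ge0_ler_powR; rewrite ?nnegrE ?powR_ge0 ?mulr_ge0 ?(ltW p0) ?(ltW eta0)//.
  have : eta <= h0 `^ p^-1 / 2 by rewrite ge_min lexx orbT.
  lra.
have [|sigma hs] := gap_pos_fixed hp A0 c0 he (hw _ eta0).
  by rewrite -(ler_pdivlMr _ _ A24); exact: hh0.
exists eta, eta, sigma; split; [exact: he|exact: eta0|exact: hs].
Qed.

End kernel.

(** * The planar inequality for negative exponents *)

Section gap_neg.
Context {R : realType}.
Local Notation RR := (measurableTypeR R).

(** The flattened body is well approximated by a segment on the double wedge |z.2| <= e |z.1|,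
    halved here by the sign of [z.1]; [cowedge] controls the error on the complement. *)
Definition pos_wedge (e p : R) (z : R * R) : R :=
  Num.max z.1 0 `^ p * boolR (`|z.2| <= e * `|z.1|).
Definition neg_wedge (e p : R) (z : R * R) : R := pos_wedge e p (- z.1, z.2).
Definition cowedge (e p : R) (z : R * R) : R :=
  `|z.2| `^ p * boolR (e * `|z.1| < `|z.2|).

Lemma pos_wedge_ge0 (e p : R) z : 0 <= pos_wedge e p z.
Proof. by rewrite mulr_ge0 ?powR_ge0 ?boolR_ge0. Qed.

Lemma neg_wedge_ge0 (e p : R) z : 0 <= neg_wedge e p z.
Proof. exact: pos_wedge_ge0. Qed.

Lemma cowedge_ge0 (e p : R) z : 0 <= cowedge e p z.
Proof. by rewrite mulr_ge0 ?powR_ge0 ?boolR_ge0. Qed.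

Lemma measurable_pos_wedge (e p : R) :
  measurable_fun [set: RR * RR] (pos_wedge e p).
Proof. by rewrite /pos_wedge; measR. Qed.

Lemma measurable_neg_wedge (e p : R) :
  measurable_fun [set: RR * RR] (neg_wedge e p).
Proof. by rewrite /neg_wedge /pos_wedge /=; measR. Qed.

Lemma measurable_cowedge (e p : R) :
  measurable_fun [set: RR * RR] (cowedge e p).
Proof. by rewrite /cowedge; measR. Qed.

Lemma wedge_sum (e p : R) z : p != 0 -> `|z.2| <= e * `|z.1| ->
  pos_wedge e p z + neg_wedge e p z = `|z.1| `^ p.
Proof.
move=> p0 ze; rewrite /neg_wedge /pos_wedge/= normrN ze boolRE !mulr1.
exact: powR_max0_sum.
Qed.

(** A negative power turns lower bounds for [h] into upper bounds. At the origin the right-hand side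
    is 0 by convention, whence the condition that [h] vanish there. *)
Lemma powR_le_wedges (e p k h : R) z : p < 0 -> 0 < e -> 0 < k ->
  (`|z.2| <= e * `|z.1| -> k * `|z.1| <= h /\ (z.1 = 0 -> h = 0)) ->
  (e * `|z.1| < `|z.2| -> e * `|z.2| <= h) ->
  h `^ p <= k `^ p * (pos_wedge e p z + neg_wedge e p z) + e `^ p * cowedge e p z.
Proof.
move=> p0 e0 k0 h1 h2; have [ze|ze] := leP `|z.2| (e * `|z.1|).
  have [hk hz] := h1 ze; rewrite wedge_sum ?lt_eqF//.
  apply: ler_wpDr; first by rewrite mulr_ge0 ?powR_ge0 ?cowedge_ge0.
  have [z0|z0] := eqVneq z.1 0.
    by rewrite hz// z0 normr0 powR0 ?lt_eqF// mulr0.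
  rewrite -powRM ?(ltW k0)//; apply: le_powR_neg => //; first exact: ltW.
  by rewrite mulr_gt0// normr_gt0.
apply: ler_wpDl.
  by rewrite mulr_ge0 ?powR_ge0 ?addr_ge0 ?pos_wedge_ge0 ?neg_wedge_ge0.
rewrite /cowedge ze boolRE mulr1 -powRM ?(ltW e0)//.
apply: le_powR_neg; [exact: ltW| |exact: h2].
by rewrite mulr_gt0// (le_lt_trans _ ze)// mulr_ge0// ltW.
Qed.

(** * Wedge estimates for a fixed asymmetry and a fixed number of dyadic pieces *)

Section fixed.
Variables (p A c e : R) (N : nat) (W : R * R -> R).
Let b : R := 2^-1 ^+ N.+1.
(** With this thickness eta / 2 = e b, so the points with z.1 > b and |z.2| <= eta / 2 all lie in
    the wedge. *)
Let eta : R := 2 * e * b.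
Hypothesis hp : -1 <= p < 0.
Hypothesis A0 : 0 < A.
Hypothesis c0 : 0 < c.
Hypothesis e0 : 0 < e.
Hypothesis e4 : e <= 4^-1.
Hypothesis N0 : (0 < N)%N.
Hypothesis ws : slab_density A c eta W.

Let pm1 : -1 <= p. Proof. by case/andP: hp. Qed.
Let p0 : p < 0. Proof. by case/andP: hp. Qed.
Let pn0 : p != 0. Proof. by rewrite lt_eqF. Qed.
Let b0 : 0 < b. Proof. by rewrite exprn_gt0. Qed.
Let eta0 : 0 < eta. Proof. by rewrite !mulr_gt0. Qed.
Let mW : measurable_fun [set: RR * RR] W. Proof. by case: ws. Qed.
Let W0 z : 0 <= W z. Proof. by case: ws => _ /(_ z)/andP[]. Qed.
Let he : 0 < e <= 1. Proof. by rewrite e0 (le_trans e4)// invf_le1 ?ler1n. Qed.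
Let J := wint W (pos_wedge e p).
Let E := wint W (cowedge e p).

Let mQ := measurable_pos_wedge e p.
Let mQn := measurable_neg_wedge e p.
Let mZ := measurable_cowedge e p.
Let Q0 := @pos_wedge_ge0 e p.
Let Qn0 := @neg_wedge_ge0 e p.
Let Z0 := @cowedge_ge0 e p.

Let wint_neg_wedge : wint W (neg_wedge e p) = J.
Proof. by have [_ _ wsym _] := ws; rewrite /J -(wint_opp mW W0 mQ Q0 wsym). Qed.

Lemma wedge_kernel_le (k : R) (f : R * R -> R) : 0 < k ->
  measurable_fun [set: RR * RR] f -> (forall z, 0 <= f z) ->
  (forall z, f z <= k `^ p * (pos_wedge e p z + neg_wedge e p z) + e `^ p * cowedge e p z) ->
  (wint W f <= (k `^ p)%:E * (J + J) + (e `^ p)%:E * E)%E.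
Proof.
move=> k0 mf f0 fle.
have QQ0 z : 0 <= pos_wedge e p z + neg_wedge e p z by rewrite addr_ge0.
have mQQ : measurable_fun [set: RR * RR] (fun z => pos_wedge e p z + neg_wedge e p z).
  exact: measurable_funD mQ mQn.
have kp0 : 0 <= k `^ p by exact: powR_ge0.
have ep0 : 0 <= e `^ p by exact: powR_ge0.
have mc (r : R) : measurable_fun [set: RR * RR] (fun=> r) by exact: measurable_cst.
rewrite -{2}wint_neg_wedge -(wintD mW W0 mQ mQn Q0 Qn0).
rewrite -(wintZ mW W0 mQQ QQ0 kp0) -(wintZ mW W0 mZ Z0 ep0).
have m1 : measurable_fun [set: RR * RR] (fun z => k `^ p * (pos_wedge e p z + neg_wedge e p z)).
  exact: measurable_funM (mc _) mQQ.
have m2 : measurable_fun [set: RR * RR] (fun z => e `^ p * cowedge e p z).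
  exact: measurable_funM (mc _) mZ.
rewrite -(wintD mW W0 m1 m2); last 2 first.
- by move=> z; rewrite mulr_ge0.
- by move=> z; rewrite mulr_ge0.
by apply: (le_wint mW W0 mf _ f0) => [|z _]; [exact: measurable_funD m1 m2|exact: fle].
Qed.

Lemma wedge_fin : J \is a fin_num.
Proof.
apply: (wint_fin W0 Q0); apply: le_trans (wint_wedge_le (ltW A0) ws pm1 (ltW e0)).
apply: (le_wint mW W0 mQ _ Q0) => [|z _]; first measR.
rewrite /pos_wedge ler_wpM2r ?boolR_ge0//.
by rewrite -powR_max0_sum// lerDl powR_ge0.
Qed.

(** The complement of the wedge is |z.1| < |z.2| / e. The bound has order eta^(p + 2), without a
    factor [N]. *)
Lemma cowedge_le : (E <= (A * (4 * e^-1 * eta `^ (p + 1) * eta))%:E)%E.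
Proof.
have e10 : 0 <= e^-1 by rewrite invr_ge0 ltW.
apply: le_trans (wint_cowedge_le (ltW A0) (ltW eta0) ws pm1 e10).
apply: (le_wint mW W0 mZ _ Z0) => [|z _]; first measR.
rewrite /cowedge ler_wpM2l ?powR_ge0//.
case: (ltP (e * `|z.1|) `|z.2|) => ze; last by rewrite boolRE boolR_ge0.
have -> : `|z.1| <= e^-1 * `|z.2| by rewrite ler_pdivlMl// ltW.
exact: lexx.
Qed.

(** Since [b] is proportional to [eta], this has order N eta^(p + 2) and dominates [E] for large
    [N]. *)
Lemma wedge_ge : ((c * eta * (N%:R / 2 * b `^ (p + 1)))%:E <= J)%E.
Proof.
apply: (wint_dyadic_ge (ltW c0) (ltW eta0) ws pm1 mQ Q0) => z /andP[bz _] z2.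
have z10 : 0 < z.1 by rewrite (lt_trans b0).
have ze : `|z.2| <= e * `|z.1|.
  apply: le_trans z2 _; rewrite gtr0_norm// /eta.
  have -> : 2 * e * b / 2 = e * b by field.
  by rewrite ler_wpM2l ?(ltW e0)// ltW.
by rewrite /pos_wedge max_l ?(ltW z10)// ze boolRE mulr1.
Qed.

Let asym_far x y : e * (`|x| + `|y|) <= asym e x + asym e y.
Proof. by rewrite mulrDr lerD ?asym_ge. Qed.

Let far1 (z : R * R) : e * `|z.1| < `|z.2| -> e * `|z.2| <= e * (`|z.1| + `|z.2|).
Proof. by move=> _; rewrite ler_wpM2l ?(ltW e0)// lerDr. Qed.

Let near1 (z : R * R) : `|z.2| <= e * `|z.1| -> z.1 = 0 -> z.2 = 0.
Proof. by move=> ze z0; apply/eqP; move: ze; rewrite z0 normr0 mulr0 normr_le0. Qed.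

Let asym0 : asym e 0 = 0. Proof. by rewrite asym_pos. Qed.

(** A crude bound with the worst slope [e] everywhere; like [neg_kernel01_le] it serves for
    finiteness. *)
Lemma neg_kernel10_le :
  (wint W (square_kernel e p 1 0) <= (e `^ p)%:E * (J + J) + (e `^ p)%:E * E)%E.
Proof.
apply: wedge_kernel_le => //; first exact: measurable_square_kernel.
  exact: square_kernel_ge0.
move=> z; rewrite square_kernel10; have := asym_far z.1 z.2 => ha.
apply: powR_le_wedges => // ze.
  split; first by apply: le_trans ha; rewrite ler_wpM2l ?(ltW e0)// lerDl.
  by move=> z0; rewrite (near1 ze z0) z0 asym0 addr0.
exact: le_trans (far1 ze) ha.
Qed.

Lemma neg_kernel01_le :
  (wint W (square_kernel e p 0 1) <= (e `^ p)%:E * (J + J) + (e `^ p)%:E * E)%E.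
Proof.
apply: wedge_kernel_le => //; first exact: measurable_square_kernel.
  exact: square_kernel_ge0.
move=> z; rewrite square_kernel01; have := asym_far z.2 (- z.1).
rewrite normrN [`|_| + _]addrC => ha.
apply: powR_le_wedges => // ze.
  split; first by apply: le_trans ha; rewrite ler_wpM2l ?(ltW e0)// lerDl.
  by move=> z0; rewrite (near1 ze z0) z0 oppr0 asym0 addr0.
exact: le_trans (far1 ze) ha.
Qed.

(** For u = 1 + i the base is at least |z.1| - |z.2| >= |z.1| / 2 on both halves of the wedge,
    because e <= 1/4. *)
Lemma neg_kernel11_le :
  (wint W (square_kernel e p 1 1) <= (2^-1 `^ p)%:E * (J + J) + (e `^ p)%:E * E)%E.
Proof.
apply: wedge_kernel_le => //; first exact: measurable_square_kernel.
  exact: square_kernel_ge0.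
move=> z; rewrite square_kernel11; have ha := asym_far (z.1 + z.2) (z.2 - z.1).
have g1 := ge_asym e (z.1 + z.2); have g2 := ge_asym e (z.2 - z.1).
have q1 := asym_ge0 (z.1 + z.2) he; have q2 := asym_ge0 (z.2 - z.1) he.
apply: powR_le_wedges => // ze.
  split; last first.
    by move=> z0; rewrite (near1 ze z0) z0 subrr addr0 asym0 addr0.
  have : `|z.2| <= 4^-1 * `|z.1| by apply: le_trans ze _; rewrite ler_wpM2r.
  rewrite ler_norml => /andP[].
  by have [z10|z10] := leP 0 z.1; [rewrite ger0_norm//|rewrite ltr0_norm//]; lra.
apply: le_trans ha; rewrite ler_wpM2l ?(ltW e0)//.
(* Off the wedge, |z.1 + z.2| + |z.2 - z.1| >= 2 |z.2|. *)
have := ler_normD (z.1 + z.2) (z.2 - z.1).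
have -> : z.1 + z.2 + (z.2 - z.1) = z.2 *+ 2 by ring.
by rewrite normrMn mulr2n; have := normr_ge0 z.2; lra.
Qed.

Let kernel_ge (f : R * R -> R) (q : R * R -> R) : wint W q = J ->
  measurable_fun [set: RR * RR] q -> (forall z, 0 <= q z) ->
  measurable_fun [set: RR * RR] f ->
  (forall z, (2 * e) `^ p * q z <= f z) ->
  (((2 * e) `^ p)%:E * J <= wint W f)%E.
Proof.
move=> <- mq q0 mf fq.
have k0 : 0 <= (2 * e) `^ p by exact: powR_ge0.
rewrite -(wintZ mW W0 mq q0 k0).
apply: (le_wint mW W0 _ mf) => [|z|z _]; last exact: fq.
- by apply: measurable_funM => //; exact: measurable_cst.
- by rewrite mulr_ge0.
Qed.

Lemma pos_wedge_le_powR (h : R) z :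
  (0 < z.1 -> `|z.2| <= e * `|z.1| -> 0 < h <= 2 * e * z.1) ->
  (2 * e) `^ p * pos_wedge e p z <= h `^ p.
Proof.
move=> hz; rewrite /pos_wedge; have [z10|z10] := leP z.1 0.
  by rewrite powR0// mul0r mulr0 powR_ge0.
have [ze|ze] := leP `|z.2| (e * `|z.1|); last by rewrite boolRE !mulr0 powR_ge0.
have /andP[h0 hle] := hz z10 ze.
rewrite boolRE mulr1 -powRM ?mulr_ge0 ?(ltW e0) ?(ltW z10)//.
by apply: le_powR_neg => //; exact: ltW.
Qed.

(** For u = i the kernel is large where z.1 > 0: there both terms of its base are at most e |z.1| on
    the wedge. For u = 1 the same happens where z.1 < 0. *)
Lemma neg_kernel01_ge :
  (((2 * e) `^ p)%:E * J <= wint W (square_kernel e p 0 1))%E.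
Proof.
apply: (kernel_ge (q := pos_wedge e p)) => //; first exact: measurable_square_kernel.
move=> z; rewrite square_kernel01; apply: pos_wedge_le_powR => z0 ze.
have h1 := asym_far z.2 (- z.1); have h2 := asym_le z.2 he.
rewrite (gtr0_norm z0) in ze.
rewrite normrN (gtr0_norm z0) in h1.
rewrite (@asym_neg _ _ (- z.1)) ?oppr_le0 ?(ltW z0)// opprK.
have a0 := asym_ge0 z.2 he.
by apply/andP; split; [rewrite ltr_wpDl// mulr_gt0|lra].
Qed.

Lemma neg_kernel10_ge :
  (((2 * e) `^ p)%:E * J <= wint W (square_kernel e p 1 0))%E.
Proof.
apply: (kernel_ge (q := neg_wedge e p)) => //; first exact: measurable_square_kernel.
move=> z; rewrite square_kernel10; apply: pos_wedge_le_powR => /= z0.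
rewrite normrN => ze; have h2 := asym_le z.2 he.
have z0' : z.1 <= 0 by rewrite -oppr_ge0 ltW.
rewrite (ler0_norm z0') in ze.
rewrite (@asym_neg _ _ z.1)//.
have a0 := asym_ge0 z.2 he.
by apply/andP; split; [rewrite ltr_wpDr// mulr_gt0|lra].
Qed.

(** The second hypothesis gives e^p E <= J. Hence the integral at 1 + i is at most 4 J + J = 5 J,
    while S = (2 e)^p J bounds the other two from below and 2^p S = (4 e)^p J = 6 J. *)
Lemma gap_neg_fixed : (4 * e) `^ p = 6 ->
  e `^ p * (A * 4 * e^-1 * (2 * e) `^ (p + 1)) <= c * N%:R / 2 ->
  exists sigma : R,
    [/\ 0 < sigma,
     sigma <= fine (wint W (square_kernel e p 1 0)) `^ (- p^-1) /\
     sigma <= fine (wint W (square_kernel e p 0 1)) `^ (- p^-1) &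
     fine (wint W (square_kernel e p 1 1)) `^ (- p^-1) < sigma / 2].
Proof.
move=> e6 hN.
have Jfin := wedge_fin; have Ele := cowedge_le; have Jge := wedge_ge.
have Efin := wint_fin W0 Z0 Ele.
have fE (X : \bar R) : X \is a fin_num -> exists r : R, X = r%:E.
  by move=> fX; exists (fine X); rewrite fineK.
have [j jE] := fE _ Jfin; have [z zE] := fE _ Efin.
have finM (k : R) (X : \bar R) : (0 <= X)%E ->
    (X <= k%:E * (J + J) + (e `^ p)%:E * E)%E -> X \is a fin_num.
  move=> X0 XM; rewrite ge0_fin_numE//; apply: le_lt_trans XM _.
  by rewrite jE [E]zE; exact: (ltry (k * (j + j) + e `^ p * z)).
have f1 := finM _ _ (wint_ge0 W0 (square_kernel_ge0 _ _ _ _)) neg_kernel10_le.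
have f2 := finM _ _ (wint_ge0 W0 (square_kernel_ge0 _ _ _ _)) neg_kernel01_le.
have f3 := finM _ _ (wint_ge0 W0 (square_kernel_ge0 _ _ _ _)) neg_kernel11_le.
have [i1 i1E] := fE _ f1; have [i2 i2E] := fE _ f2; have [i3 i3E] := fE _ f3.
have := neg_kernel11_le; have := neg_kernel10_ge; have := neg_kernel01_ge.
have := wint_ge0 W0 (square_kernel_ge0 e p 1 1).
move: Ele Jge; rewrite /E i1E i2E i3E jE zE !lee_fin /=.
move=> zle jge i30 l2 l1 u3.
have ee : (2 * e * b) `^ (p + 1) = (2 * e) `^ (p + 1) * b `^ (p + 1).
  by rewrite powRM ?mulr_ge0 ?(ltW e0) ?(ltW b0).
have bp : 0 < b `^ (p + 1) by exact: powR_gt0.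
have j0 : 0 < j.
  apply: lt_le_trans jge; rewrite mulr_gt0 ?mulr_gt0 ?divr_gt0 ?ltr0n//.
(* Both bounds contain eta b^(p + 1), and what remains is the hypothesis on [N]. *)
have zj : e `^ p * z <= j.
  apply: le_trans jge.
  apply: le_trans (ler_wpM2l (powR_ge0 _ _) zle) _.
  have := ler_wpM2r (ltW (mulr_gt0 bp eta0)) hN.
  rewrite {3}/eta ee; lra.
(* This uses -1 <= p. *)
have h2 : 2^-1 `^ p <= 2.
  rewrite -(powR_inv1 (ler0n _ 2)) -powRrM mulN1r -[leRHS](@powRr1 _ 2)//.
  by apply: ler_powR; [lra|have := pm1; lra].
have e60 : 2 `^ p * (2 * e) `^ p = 6.
  rewrite -powRM ?mulr_ge0 ?(ltW e0)//.
  by have -> : 2 * (2 * e) = 4 * e by ring.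
exists (((2 * e) `^ p * j) `^ (- p^-1)).
apply: powR_gap_neg => //; first by rewrite mulr_gt0// powR_gt0// mulr_gt0.
rewrite i30 mulrA e60/=.
have : 2^-1 `^ p * (j + j) <= 2 * (j + j) by rewrite ler_wpM2r// addr_ge0 ?ltW.
lra.
Qed.

End fixed.

Lemma square_kernel_gap_neg (p A c : R) (w : R -> R * R -> R) :
  -1 <= p < 0 -> 0 < A -> 0 < c ->
  (forall eta, 0 < eta -> slab_density A c eta (w eta)) ->
  exists e eta sigma : R,
    [/\ 0 < e <= 1, 0 < eta & [/\ 0 < sigma,
     sigma <= fine (wint (w eta) (square_kernel e p 1 0)) `^ (- p^-1) /\
     sigma <= fine (wint (w eta) (square_kernel e p 0 1)) `^ (- p^-1) &
     fine (wint (w eta) (square_kernel e p 1 1)) `^ (- p^-1) < sigma / 2]].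
Proof.
move=> /[dup] hp /andP[pm1 p0] A0 c0 hw.
have pn0 : p != 0 by rewrite lt_eqF.
(* The solution of (4 e)^p = 6; it is at most 1/4 because p < 0. *)
pose e : R := 6 `^ p^-1 / 4.
have e0 : 0 < e by rewrite divr_gt0// powR_gt0.
have e4 : e <= 4^-1.
  rewrite ler_piMl// -[leRHS](powRr0 6); apply: ler_powR; first lra.
  by rewrite invr_le0 ltW.
have e6 : (4 * e) `^ p = 6.
  by rewrite /e mulrCA divff// mulr1 powRVK.
pose K := e `^ p * (A * 4 * e^-1 * (2 * e) `^ (p + 1)).
(* [K] does not depend on [N], so [e] is fixed first and the thickness is then reduced through
   [N]. *)
pose N := (Num.truncn (2 * K / c)).+1.
have hN : K <= c * N%:R / 2.
  have : 2 * K / c <= N%:R by rewrite ltW// truncnS_gt.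
  by rewrite ler_pdivrMr//; lra.
pose eta : R := 2 * e * 2^-1 ^+ N.+1.
have eta0 : 0 < eta.
  apply: mulr_gt0; first exact: mulr_gt0.
  by apply: exprn_gt0; rewrite invr_gt0 ltr0n.
have [sigma hs] := gap_neg_fixed hp A0 c0 e0 e4 (N := N) isT (hw _ eta0) e6 hN.
exists e, eta, sigma; split; [|exact: eta0|exact: hs].
by rewrite e0 (le_trans e4)// invf_le1 ?ler1n.
Qed.

End gap_neg.

(** * Reduction to the plane *)

Section tonelli_tuple.
Context {R : realType}.
Local Notation RR := (measurableTypeR R).
Local Notation mu := (@lebesgue_measure R).

Lemma integral_lebesgue_tupleS (m : nat) (f : m.+1.-tuple R -> \bar R) :
  measurable_fun [set: m.+1.-tuple R] f -> (forall t, 0 <= f t)%E ->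
  (\int[lebesgue_tuple m.+1]_t f t =
   \int[mu]_s \int[lebesgue_tuple m]_y f (tuple_cons (s, y)))%E.
Proof.
move=> mf f0.
have mc : measurable_fun [set: RR * m.-tuple R] (@tuple_cons R m).
  exact: measurable_tuple_cons.
rewrite [LHS](@ge0_integral_pushforward _ _ _ _ _ _ mc)//.
have mfc : measurable_fun [set: RR * m.-tuple R] (f \o @tuple_cons R m).
  exact: measurableT_comp mf mc.
have fc0 z : (0 <= (f \o @tuple_cons R m) z)%E by exact: f0.
exact: (fubini_tonelli1 (m1 := mu) (m2 := lebesgue_tuple m) _ mfc fc0).
Qed.

Definition sqnorm (m : nat) (t : m.-tuple R) : R := \sum_(i < m) tnth t i ^+ 2.

Lemma measurable_sqnorm m : measurable_fun [set: m.-tuple R] (@sqnorm m).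
Proof.
by apply: measurable_sum => i; apply: measurable_funX; exact: measurable_tnth.
Qed.

Lemma sqnorm_ge0 m (t : m.-tuple R) : 0 <= sqnorm t.
Proof. by apply: sumr_ge0 => i _; exact: sqr_ge0. Qed.

Lemma tnth_tuple_cons0 m (s : R) (t : m.-tuple R) :
  tnth (tuple_cons (s, t)) ord0 = s.
Proof. by []. Qed.

Lemma tnth_tuple_consS m (s : R) (t : m.-tuple R) i :
  tnth (tuple_cons (s, t)) (lift ord0 i) = tnth t i.
Proof. exact: tnthS. Qed.

Lemma sqnorm_cons m (s : R) (t : m.-tuple R) :
  sqnorm (tuple_cons (s, t)) = s ^+ 2 + sqnorm t.
Proof.
rewrite /sqnorm big_ord_recl; congr (_ + _).
by apply: eq_bigr => i _; rewrite tnth_tuple_consS.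
Qed.

Lemma measurable_ball_tuple m (x : R) :
  measurable [set t : m.-tuple R | sqnorm t <= x].
Proof.
have := @measurable_fun_ler _ _ R setT _ _ (@measurable_sqnorm m) (measurable_cst x).
move=> /(_ measurableT [set true]).
rewrite setTI; apply.
by [].
Qed.

(* The maximum keeps the volume bounded on the whole line. *)
Definition slice_vol (m : nat) (r : R) : R :=
  fine (lebesgue_tuple m [set t : m.-tuple R | sqnorm t <= 1 - Num.max 0 r]).

Lemma lebesgue_tuple_cube m (a : R) : 0 <= a ->
  lebesgue_tuple m [set t | forall i, `[- a, a]%classic (tnth t i)] =
  ((a *+ 2) ^+ m)%:E.
Proof.
move=> a0; rewrite (@lebesgue_tuple_box R m (fun=> `[- a, a]%classic))//.
have -> : lebesgue_measure `[- a, a]%classic = (a *+ 2)%:E.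
  rewrite lebesgue_measure_itv/= lte_fin; case: ltP => aa.
    by rewrite -EFinB opprK mulr2n.
  have -> : a = 0 by lra.
  by rewrite mul0rn.
by rewrite prodEFin prodr_const card_ord.
Qed.

Lemma measurable_cube m (a : R) :
  measurable [set t : m.-tuple R | forall i, `[- a, a]%classic (tnth t i)].
Proof.
rewrite (_ : [set _ | _] =
    \bigcap_(i : 'I_m) (fun t => tnth t i) @^-1` `[- a, a]%classic); last first.
  by apply/seteqP; split => t /= h i *; exact: h.
apply: fin_bigcap_measurable => // i _.
by rewrite -[_ @^-1` _]setTI; exact: measurable_tnth.
Qed.

Lemma slice_le m (x : R) : x <= 1 ->
  (lebesgue_tuple m [set t : m.-tuple R | (sqnorm t <= x)%R] <= (2 ^+ m)%:E)%E.
Proof.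
move=> x1; rewrite -[2]/(1 *+ 2) -lebesgue_tuple_cube//.
apply: le_measure; rewrite ?inE; [exact: measurable_ball_tuple|exact: measurable_cube|].
move=> t /= tx i; rewrite in_itv/= -ler_norml -(expr_le1 (n := 2))// -normrX.
rewrite ger0_norm ?sqr_ge0//; apply: le_trans (le_trans tx x1).
rewrite /sqnorm (bigD1 i)//= lerDl; apply: sumr_ge0 => j _; exact: sqr_ge0.
Qed.

Lemma slice_fin m (r : R) :
  lebesgue_tuple m [set t : m.-tuple R | sqnorm t <= 1 - Num.max 0 r] \is a fin_num.
Proof.
rewrite ge0_fin_numE//; apply: le_lt_trans (slice_le _ _) (ltry _).
by rewrite gerBl le_max lexx.
Qed.

Lemma slice_vol_ge0 m r : 0 <= slice_vol m r.
Proof. by rewrite fine_ge0. Qed.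

Lemma slice_vol_le m r : slice_vol m r <= 2 ^+ m.
Proof.
rewrite -lee_fin fineK ?slice_fin//; apply: slice_le.
by rewrite gerBl le_max lexx.
Qed.

Lemma slice_vol_noninc m : {homo slice_vol m : x y / x <= y >-> y <= x}.
Proof.
move=> x y xy; rewrite -lee_fin !fineK ?slice_fin//.
apply: le_measure; rewrite ?inE; [exact: measurable_ball_tuple|exact: measurable_ball_tuple|].
move=> t /= h; apply: le_trans h _; rewrite lerB//.
by rewrite ge_max !le_max lexx xy orbT.
Qed.

Lemma slice_vol_gt1 m r : 1 < r -> slice_vol m r = 0.
Proof.
move=> r1; rewrite /slice_vol (_ : [set _ | _] = set0) ?measure0//.
apply/seteqP; split => t //= h; have := sqnorm_ge0 t.
by have := le_max r 0 r; rewrite lexx orbT => rm; lra.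
Qed.

(** The cube of half-side 1 / (m + 1) fits into the ball of squared radius 1/2, as m / (m + 1)^2 <=
    1/2; the shift by 1 covers m = 0. *)
Lemma slice_vol_ge m r : r <= 2^-1 ->
  (m.+1%:R^-1 *+ 2) ^+ m <= slice_vol m r.
Proof.
move=> r2; rewrite -lee_fin fineK ?slice_fin// -lebesgue_tuple_cube ?invr_ge0//.
apply: le_measure; rewrite ?inE; [exact: measurable_cube|exact: measurable_ball_tuple|].
move=> t /= h.
have m0 : 0 < m.+1%:R :> R by rewrite ltr0n.
have hm : Num.max 0 r <= 2^-1 by rewrite ge_max r2 andbT.
apply: (@le_trans _ _ (2^-1)); last by lra.
apply: (@le_trans _ _ (\sum_(i < m) (m.+1%:R^-1 ^+ 2))).
  apply: ler_sum => i _; have := h i; rewrite in_itv/= -ler_norml => hi.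
  by rewrite -[leLHS]ger0_norm ?sqr_ge0// normrX ler_pXn2r// nnegrE invr_ge0.
rewrite sumr_const card_ord -[leLHS]mulr_natl exprVn ler_pdivrMr ?exprn_gt0//.
have : m.+1%:R = m%:R + 1 :> R by rewrite -natr1.
have : 0 <= m%:R :> R by [].
move=> h1 ->; nra.
Qed.

(** The volume of the fibre of the flattened ball over a point of the first complex line, that is,
    the density of its projection. *)
Definition ellipsoid_slice (m : nat) (eta : R) (z : R * R) : R :=
  slice_vol m (z.1 ^+ 2 + (z.2 / eta) ^+ 2).

(** Outside the rectangle the fibre is empty; on the half-size rectangle the sum of squares is at
    most 1/4 + 1/4. Neither constant depends on [eta]. *)
Lemma slab_density_ellipsoid_slice m (eta : R) : 0 < eta ->
  slab_density (2 ^+ m) ((m.+1%:R^-1 *+ 2) ^+ m) eta (ellipsoid_slice m eta).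
Proof.
move=> eta0; split.
- have ms : measurable_fun [set: R] (@slice_vol m).
    by apply: nonincreasing_measurable => // x y; exact: slice_vol_noninc.
  apply: (measurableT_comp ms); apply: measurable_funD.
    by apply: measurable_funX; exact: measurable_fst_real.
  by apply: measurable_funX; measR.
- move=> z; rewrite /ellipsoid_slice slice_vol_ge0/=.
  have [z1|z1] := leP `|z.1| 1; last first.
    rewrite slice_vol_gt1 ?mulr_ge0 ?boolR_ge0// ltr_wpDr ?sqr_ge0//.
    by rewrite -(@ger0_norm _ (z.1 ^+ 2)) ?sqr_ge0// normrX expr_gt1.
  have [z2|z2] := leP `|z.2| eta; last first.
    rewrite slice_vol_gt1 ?mulr_ge0 ?boolR_ge0// ltr_wpDl ?sqr_ge0//.
    rewrite -(@ger0_norm _ (_ ^+ 2)) ?sqr_ge0// normrX expr_gt1//.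
    by rewrite normrM normfV (gtr0_norm eta0) ltr_pdivlMr// mul1r.
  by rewrite !boolRE !mulr1 slice_vol_le.
- by move=> s t; rewrite /ellipsoid_slice/= sqrrN.
- move=> z z1 z2; apply: slice_vol_ge.
  have h1 : z.1 ^+ 2 <= 2^-1 ^+ 2.
    by rewrite -(@ger0_norm _ (z.1 ^+ 2)) ?sqr_ge0// normrX ler_pXn2r// nnegrE.
  have h2 : (z.2 / eta) ^+ 2 <= 2^-1 ^+ 2.
    rewrite -(@ger0_norm _ (_ ^+ 2)) ?sqr_ge0// normrX ler_pXn2r// ?nnegrE//.
    by rewrite normrM normfV (gtr0_norm eta0) ler_pdivrMr// mulrC.
  lra.
Qed.

(** Tonelli in the first two coordinates: [f] is constant on each fibre, and the fibre is a ball in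
    the remaining [m] coordinates. *)
Lemma integral_tuple_slice (m : nat) (eta : R) (f : R * R -> R) : 0 < eta ->
  measurable_fun [set: RR * RR] f -> (forall z, 0 <= f z) ->
  (\int[lebesgue_tuple m.+2]_t
     (f (tnth t ord0, tnth t (lift ord0 ord0)) *
      boolR (sqnorm t + (eta^-2 - 1) * tnth t (lift ord0 ord0) ^+ 2 <= 1))%:E =
   wint (ellipsoid_slice m eta) f)%E.
Proof.
move=> eta0 mf f0.
set F := fun t : m.+2.-tuple R => (_ * boolR _)%:E.
have F0 t : (0 <= F t)%E by rewrite lee_fin mulr_ge0 ?boolR_ge0.
have mF : measurable_fun [set: m.+2.-tuple R] F.
  apply/measurable_EFinP; apply: measurable_funM.
    apply: (measurableT_comp mf).
    by apply: measurable_fun_pair; exact: measurable_tnth.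
  apply: measurable_fun_boolR; apply: measurable_fun_ler; last exact: measurable_cst.
  apply: measurable_funD; first exact: measurable_sqnorm.
  apply: measurable_funM; first exact: measurable_cst.
  by apply: measurable_funX; exact: measurable_tnth.
have FE s t y : F (tuple_cons (s, tuple_cons (t, y))) =
    (f (s, t) * boolR (sqnorm y <= 1 - (s ^+ 2 + (t / eta) ^+ 2)))%:E.
  rewrite /F !sqnorm_cons !tnth_tuple_consS !tnth_tuple_cons0; congr (_ * boolR _)%:E.
  rewrite -[LHS]subr_ge0 -[RHS]subr_ge0; congr (0 <= _).
  by rewrite expr_div_n; ring.
rewrite integral_lebesgue_tupleS//.
rewrite /wint fubini_tonelli1//=; last 2 first.
- apply/measurable_EFinP/measurable_funM => //.
  by have [] := slab_density_ellipsoid_slice m eta0.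
- by move=> z; rewrite lee_fin mulr_ge0// slice_vol_ge0.
apply: eq_integral => s _; rewrite /fubini_F/=.
rewrite integral_lebesgue_tupleS; last 2 first.
- have ms : measurable_fun [set: m.+1.-tuple R]
      (fun y : m.+1.-tuple R => tuple_cons ((s : R), y)).
    exact: (measurable_cons (measurable_cst (s : R)) (@measurable_id _ _ setT)).
  exact: (measurableT_comp mF ms).
- by move=> y; exact: F0.
apply: eq_integral => t _.
rewrite [LHS](_ : _ = \int[lebesgue_tuple m]_y ((f (s, t))%:E *
    (boolR (sqnorm y <= 1 - (s ^+ 2 + (t / eta) ^+ 2))%R)%:E))%E; last first.
  by apply: eq_integral => y _; rewrite -EFinM; exact: FE.
rewrite ge0_integralZl_EFin//; last 2 first.
- by move=> y _; rewrite lee_fin boolR_ge0.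
- apply/measurable_EFinP/measurable_fun_boolR/measurable_fun_ler => //.
  exact: measurable_sqnorm.
rewrite EFinM /ellipsoid_slice /slice_vol fineK ?slice_fin//; congr (_ * _)%E.
have rs : 0 <= s ^+ 2 + (t / eta) ^+ 2 by rewrite addr_ge0 ?sqr_ge0.
rewrite max_r//= -[in RHS](setIT [set _ | _]) -integral_indic//; last exact: measurable_ball_tuple.
apply: eq_integral => y _; rewrite indicE /boolR; congr ((nat_of_bool _)%:R)%:E.
by apply/idP/idP; rewrite inE.
Qed.

End tonelli_tuple.

(** * The square and the ellipsoid *)

Section bodies.
Context {R : realType}.

Definition square (e : R) : set 'rV[R]_2 :=
  [set c | forall j, `[- e, 1]%classic (c ord0 j)].

Lemma squareP (e : R) c : square e c <-> forall j, - e <= c ord0 j <= 1.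
Proof.
split=> [h j|h j]; first by have := h j; rewrite /= in_itv.
by rewrite /= in_itv/= h.
Qed.

Lemma convex_body0_square (e : R) : 0 < e -> convex_body0 (square e).
Proof.
move=> e0; split.
- by apply: (@rV_compact R 2 (fun=> `[- e, 1]%classic)) => _; exact: segment_compact.
- move=> x y l; rewrite !inE => /squareP hx /squareP hy; apply/squareP => j.
  have -> : conv l (x : convex_lmodType 'rV[R]_2) y = l%:num *: x + (1 - l%:num) *: y by [].
  rewrite !mxE.
  have l0 : 0 <= l%:num by [].
  have l1 : l%:num <= 1 by [].
  have /andP[x1 x2] := hx j; have /andP[y1 y2] := hy j.
  apply/andP; split; nra.
- apply/nbhs_ballP; exists (Num.min e 1); first by rewrite /= lt_min e0 ltr01.
  move=> y [_ hy]; apply/squareP => j; have := hy ord0 j.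
  rewrite /ball/= mxE sub0r normrN lt_min => /andP[ye y1].
  by move: ye y1; rewrite !ltr_norml => /andP[? ?] /andP[? ?]; apply/andP; split; apply: ltW.
Qed.

Lemma sum_I2 (V : zmodType) (f : 'I_2 -> V) : \sum_j f j = f 0 + f 1.
Proof. by rewrite big_ord_recl big_ord1; congr (_ + f _); exact: val_inj. Qed.

Lemma dot_ord0 m (x y : 'M[R]_(m.+1, 2)) :
  dot x y = x ord0 0 * y ord0 0 + x ord0 1 * y ord0 1 +
    \sum_(i < m) \sum_(j < 2) x (lift ord0 i) j * y (lift ord0 i) j.
Proof. by rewrite /dot big_ord_recl sum_I2. Qed.

Definition axis_vec m (a0 a1 : R) : 'M[R]_(m.+1, 2) :=
  \matrix_(i, j) (if i == ord0 then if j == 0 then a0 else a1 else 0).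

Lemma dot_axis_vec m (x : 'M[R]_(m.+1, 2)) (c : 'rV[R]_2) (a0 a1 : R) :
  dot x (Defs.cscale c (axis_vec m a0 a1)) =
  c ord0 0 * (x ord0 0 * a0 + x ord0 1 * a1) +
  c ord0 1 * (x ord0 1 * a0 - x ord0 0 * a1).
Proof.
rewrite dot_ord0 [X in _ + X]big1 ?addr0.
  by rewrite !mxE/=; ring.
move=> i _; rewrite sum_I2 !mxE/=; ring.
Qed.

(** The support function of a product is the sum of those of the factors, here attained at a vertex
    of the square. *)
Lemma support_fun_square m (e : R) (x : 'M[R]_(m.+1, 2)) (a0 a1 : R) : 0 < e ->
  support_fun (csetscale (square e) (axis_vec m a0 a1)) x =
  asym e (x ord0 0 * a0 + x ord0 1 * a1) + asym e (x ord0 1 * a0 - x ord0 0 * a1).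
Proof.
move=> e0; set u := x ord0 0 * a0 + _; set v := x ord0 1 * a0 - _.
rewrite /support_fun; set S := [set _ | _ in _].
have ubS : ubound S (asym e u + asym e v).
  move=> _ [_ [c /squareP hc <-] <-]; rewrite dot_axis_vec -/u -/v.
  have aux (k z : R) : - e <= k <= 1 -> k * z <= asym e z.
    move=> /andP[k1 k2]; have [z0|z0] := leP 0 z.
      by rewrite asym_pos//; nra.
    by rewrite asym_neg ?(ltW z0)//; nra.
  by apply: lerD; apply: aux; exact: hc.
pose k (z : R) : R := if 0 <= z then 1 else - e.
have kE z : k z * z = asym e z.
  rewrite /k; case: (leP 0 z) => z0; first by rewrite asym_pos// mul1r.
  by rewrite asym_neg ?(ltW z0)//; ring.
have kb z : - e <= k z <= 1.
  by rewrite /k; case: (leP 0 z) => z0; apply/andP; split; lra.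
have SS : S (asym e u + asym e v).
  pose c : 'rV[R]_2 := \row_j (if j == 0 then k u else k v).
  exists (Defs.cscale c (axis_vec m a0 a1)).
    by exists c => //; apply/squareP => j; rewrite mxE; case: ifP.
  by rewrite dot_axis_vec -/u -/v !mxE/= !kE.
apply/eqP; rewrite eq_le; apply/andP; split.
  by apply: ge_sup => //; exists (asym e u + asym e v).
by apply: ub_le_sup => //; exists (asym e u + asym e v).
Qed.

(* The coefficient replaces the square of the imaginary part of the first
   coordinate in [dot x x] by its quotient by [eta ^+ 2]. *)
Definition flat_ellipsoid m (eta : R) : set 'M[R]_(m.+1, 2) :=
  [set x | dot x x + (eta^-2 - 1) * x ord0 1 ^+ 2 <= 1].

Definition flatten_map m (eta : R) (x : 'M[R]_(m.+1, 2)) : 'M[R]_(m.+1, 2) :=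
  \matrix_(i, j) ((if (i == ord0) && (j == 1) then eta else 1) * x i j).

Lemma flatten_map_is_linear m eta : linear (@flatten_map m eta).
Proof. by move=> k x y; apply/matrixP => i j; rewrite !mxE; ring. Qed.

HB.instance Definition _ m eta :=
  GRing.isLinear.Build R 'M[R]_(m.+1, 2) 'M[R]_(m.+1, 2) _ (@flatten_map m eta)
    (@flatten_map_is_linear m eta).

Lemma dot_flatten_map m eta (x : 'M[R]_(m.+1, 2)) :
  dot (flatten_map eta x) (flatten_map eta x) =
  dot x x + (eta ^+ 2 - 1) * x ord0 1 ^+ 2.
Proof.
rewrite !dot_ord0 !mxE/=.
under eq_bigr do under eq_bigr do rewrite !mxE/= !mul1r.
by ring.
Qed.

Lemma flatten_mapK m eta : eta != 0 -> cancel (@flatten_map m eta^-1) (@flatten_map m eta).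
Proof.
move=> eta0 x; apply/matrixP => i j; rewrite !mxE mulrA.
by case: ifP => _; rewrite ?divff// ?mulr1 mul1r.
Qed.

Lemma enorm_le1 n (x : 'M[R]_(n, 2)) : (enorm x <= 1) = (dot x x <= 1).
Proof. by rewrite /enorm -[X in _ <= X]sqrtr1 ler_sqrt. Qed.

Lemma ellipsoid_flat m (eta : R) : 0 < eta -> ellipsoid (@flat_ellipsoid m eta).
Proof.
move=> eta0; have en0 : eta != 0 by rewrite gt_eqF.
split.
  exists (@flatten_map m eta), 0; apply/seteqP; split => [x hx|_ [y hy <-]].
    exists (flatten_map eta^-1 x); last by rewrite add0r; exact: flatten_mapK.
    by rewrite /= enorm_le1 dot_flatten_map exprVn.
  move: hy; rewrite /= enorm_le1 add0r /flat_ellipsoid/= dot_flatten_map !mxE/=.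
  by congr (_ <= _); field.
exists 0; apply/nbhs_ballP.
(* [M] bounds the sum of the absolute values of the coefficients of the quadratic form. As M >= 1,
   coordinates below 1 / M have squares below 1 / M, and the form is at most 1. *)
pose M : R := m.+1%:R * 2 + `|eta^-2 - 1|.
have M1 : 1 <= M.
  have : 1 <= m.+1%:R :> R by rewrite ler1n.
  by have := normr_ge0 (eta^-2 - 1); rewrite /M; lra.
have M0 : 0 < M by lra.
exists M^-1; first by rewrite /= invr_gt0.
move=> y [_ hy]; rewrite /flat_ellipsoid/=.
have hij i j : y i j ^+ 2 <= M^-1.
  have := hy i j; rewrite /ball/= mxE sub0r normrN => yM.
  rewrite -(@ger0_norm _ (_ ^+ 2)) ?sqr_ge0// normrX.
  apply: (@le_trans _ _ (M^-1 ^+ 2)).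
    by rewrite ler_pXn2r ?nnegrE ?invr_ge0 ?(ltW M0)// ltW.
  rewrite expr2 ler_piMl ?invr_ge0 ?(ltW M0)// invf_le1//.
have h1 : dot y y <= m.+1%:R * 2 * M^-1.
  rewrite /dot; apply: (@le_trans _ _ (\sum_(i < m.+1) (2 * M^-1))).
    by apply: ler_sum => i _; rewrite sum_I2 -!expr2; have := hij i 0; have := hij i 1; lra.
  by rewrite sumr_const card_ord -[leLHS]mulr_natl mulrA.
have h2 : (eta^-2 - 1) * y ord0 1 ^+ 2 <= `|eta^-2 - 1| * M^-1.
  apply: (@le_trans _ _ (`|eta^-2 - 1| * y ord0 1 ^+ 2)).
    by rewrite ler_wpM2r ?sqr_ge0// ler_norm.
  by rewrite ler_wpM2l.
apply: (le_trans (lerD h1 h2)).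
by rewrite -mulrDl -/M divff// gt_eqF.
Qed.

Lemma origin_symmetric_flat m (eta : R) : origin_symmetric (@flat_ellipsoid m eta).
Proof.
move=> x; rewrite /flat_ellipsoid /= !mxE sqrrN.
have -> // : dot (- x) (- x) = dot x x.
by apply: eq_bigr => i _; apply: eq_bigr => j _; rewrite !mxE mulrNN.
Qed.

(** Matrices are flattened through the enumeration of index pairs. Its first two entries identify
    the first two coordinates of a tuple with the first complex coordinate. *)
Lemma enum_prod_I2 m : enum [the finType of ('I_m.+1 * 'I_2)%type] =
  (ord0, ord0) :: (ord0, lift ord0 ord0) ::
  [seq (x, y) | x <- [seq lift ord0 i | i <- enum 'I_m], y <- enum 'I_2].
Proof.
rewrite enumT unlock /= /prod_enum enum_ordSl /= !enum_ordSl enum_ord0 /=.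
by [].
Qed.

Lemma mxvec_index00 m : mxvec_index (ord0 : 'I_m.+1) (0 : 'I_2) = ord0 :> 'I_(m.+1 * 2).
Proof.
apply: val_inj => /=.
rewrite /enum_rank enum_rank_in.unlock insubdK; last first.
  by rewrite -topredE /= cardE index_mem mem_enum.
by rewrite enum_prod_I2.
Qed.

Lemma mxvec_index01 m :
  mxvec_index (ord0 : 'I_m.+1) (1 : 'I_2) = lift ord0 ord0 :> 'I_(m.+1 * 2).
Proof.
apply: val_inj => /=.
rewrite /enum_rank enum_rank_in.unlock insubdK; last first.
  by rewrite -topredE /= cardE index_mem mem_enum.
by rewrite enum_prod_I2.
Qed.

End bodies.

(** * From the planar gap to non-convexity *)

Section final.
Context {R : realType}.

Lemma point_of_tupleE n (t : (n * 2).-tuple R) i j :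
  point_of_tuple t i j = tnth t (mxvec_index i j).
Proof. by rewrite /point_of_tuple !mxE. Qed.

Lemma dot_point_of_tuple n (t : (n * 2).-tuple R) :
  dot (point_of_tuple t) (point_of_tuple t) = sqnorm t.
Proof.
rewrite /dot /sqnorm pair_big/= [RHS](reindex _ (curry_mxvec_bij _ _))/=.
by apply: eq_bigr => -[i j] _ /=; rewrite !point_of_tupleE expr2.
Qed.

(** The support function involves only the first complex coordinate, so the other coordinates
    integrate to the slice volume. *)
Lemma support_integral_flat m (e p eta a0 a1 : R) : 0 < e -> 0 < eta ->
  support_integral (square e) p (@flat_ellipsoid R m eta) (axis_vec m a0 a1) =
  wint (ellipsoid_slice (m * 2) eta) (square_kernel e p a0 a1).
Proof.
move=> e0 eta0.
rewrite -(@integral_tuple_slice R (m * 2) eta _ eta0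
  (@measurable_square_kernel R e p a0 a1) (@square_kernel_ge0 R e p a0 a1)).
rewrite /support_integral integral_mkcond.
apply: (@eq_integral _ _ _ (lebesgue_tuple (m.+1 * 2))) => t _.
rewrite patchE support_fun_square// !point_of_tupleE mxvec_index00 mxvec_index01.
have -> : (t \in point_of_tuple @^-1` flat_ellipsoid eta) =
    (sqnorm t + (eta^-2 - 1) * tnth t (lift ord0 ord0) ^+ 2 <= 1).
  apply/idP/idP; rewrite inE /flat_ellipsoid/= dot_point_of_tuple point_of_tupleE mxvec_index01//.
rewrite /square_kernel/=; case: ifP => _; first by rewrite boolRE mulr1.
by rewrite boolRE mulr0.
Qed.

Lemma square_kernelZ (e p r a0 a1 : R) z : 0 < e <= 1 -> 0 < r ->
  square_kernel e p (r * a0) (r * a1) z = r `^ p * square_kernel e p a0 a1 z.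
Proof.
move=> he r0.
have aZ x : asym e (r * x) = r * asym e x.
  by rewrite /asym maxr_pMr ?(ltW r0)//; congr Num.max; ring.
rewrite /square_kernel -powRM ?addr_ge0 ?asym_ge0 ?(ltW r0)//.
by rewrite mulrDr -!aZ; congr (powR (asym _ _ + asym _ _) _); ring.
Qed.

Lemma sphere_axis_vec m (a0 a1 : R) : a0 ^+ 2 + a1 ^+ 2 = 1 ->
  sphere (axis_vec m a0 a1).
Proof.
move=> a1E; rewrite /sphere/= /enorm dot_ord0 [X in _ + X]big1 ?addr0; last first.
  by move=> i _; rewrite sum_I2 !mxE/= !mulr0 addr0.
by rewrite !mxE/= -!expr2 a1E sqrtr1.
Qed.

Lemma axis_vecZ m (r a0 a1 : R) : r *: axis_vec m a0 a1 = axis_vec m (r * a0) (r * a1).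
Proof.
apply/matrixP => i j; rewrite !mxE; case: ifP; rewrite ?mulr0// => _.
by case: ifP.
Qed.

Lemma axis_vecD m (a0 a1 b0 b1 : R) :
  axis_vec m a0 a1 + axis_vec m b0 b1 = axis_vec m (a0 + b0) (a1 + b1).
Proof.
apply/matrixP => i j; rewrite !mxE; case: ifP; rewrite ?addr0// => _.
by case: ifP.
Qed.

(** Polar coordinates are unique away from the origin: the norm determines [l], then [u]. *)
Lemma body_scale_le n C (p : R) (K : set 'M[R]_(n, 2)) u (l : R) :
  sphere u -> 0 <= l -> complex_Lp_intersection_body C p K (l *: u) ->
  l <= Ip_radial C p K u.
Proof.
move=> su l0 [v [k [sv /andP[k0 kI] luv]]].
have lk : l = k.
  by have := congr1 enorm luv; rewrite !enormZ// su sv !mulr1.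
have [->|ln0] := eqVneq l 0; first exact: powR_ge0.
suff -> : u = v by rewrite lk.
have := congr1 (GRing.scale l^-1) luv.
by rewrite -lk !scalerA mulVf// !scale1r.
Qed.

(** With r = 1 / sqrt 2, the midpoint of sigma and sigma i is sigma / (2 r) times the unit vector r
    + i r, beyond the radius in that direction. *)
Lemma not_convex_of_gap m C (p : R) (K : set 'M[R]_(m.+1, 2)) (r sigma : R) :
  0 < r -> r ^+ 2 = 2^-1 -> 0 < sigma ->
  sigma <= Ip_radial C p K (axis_vec m 1 0) ->
  sigma <= Ip_radial C p K (axis_vec m 0 1) ->
  Ip_radial C p K (axis_vec m r r) < sigma / (r *+ 2) ->
  ~ convex_set (complex_Lp_intersection_body C p K).
Proof.
move=> r0 r2 s0 h1 h2 h3 cvx.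
have B1 : complex_Lp_intersection_body C p K (sigma *: axis_vec m 1 0).
  exists (axis_vec m 1 0), sigma; split => //; last by rewrite h1 ltW.
  by apply: sphere_axis_vec; ring.
have B2 : complex_Lp_intersection_body C p K (sigma *: axis_vec m 0 1).
  exists (axis_vec m 0 1), sigma; split => //; last by rewrite h2 ltW.
  by apply: sphere_axis_vec; ring.
have h0 : 0 <= 2^-1 :> R by [].
have h01 : 2^-1 <= 1 :> R by rewrite invf_le1 ?ler1n.
pose half : {i01 R} := Itv01 h0 h01.
have := cvx _ _ half (mem_set B1) (mem_set B2).
rewrite inE.
have -> : conv half (sigma *: axis_vec m 1 0 : convex_lmodType 'M[R]_(m.+1, 2))
    (sigma *: axis_vec m 0 1) = (sigma / (r *+ 2)) *: axis_vec m r r.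
  have -> : conv half (sigma *: axis_vec m 1 0 : convex_lmodType 'M[R]_(m.+1, 2))
    (sigma *: axis_vec m 0 1) = 2^-1 *: (sigma *: axis_vec m 1 0) +
     (1 - 2^-1) *: (sigma *: axis_vec m 0 1) by [].
  rewrite !axis_vecZ axis_vecD; congr axis_vec.
    by field; rewrite gt_eqF.
  by field; rewrite gt_eqF.
move=> B3.
have sr : sphere (axis_vec m r r) by apply: sphere_axis_vec; rewrite r2; field.
have d0 : 0 <= sigma / (r *+ 2) by rewrite divr_ge0 ?(ltW s0)// mulrn_wge0 ?(ltW r0).
by have := body_scale_le sr d0 B3; rewrite leNgt h3.
Qed.

Lemma fine_mule (r : R) (x : \bar R) : 0 < r -> fine (r%:E * x) = r * fine x.
Proof.
move=> r0; case: x => [x| |] //=.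
  by rewrite gt0_muley ?lte_fin// mulr0.
by rewrite gt0_muleNy ?lte_fin// mulr0.
Qed.

(** Homogeneity of degree -1 in the direction, which lets the planar gap be stated for 1 + i without
    normalization. *)
Lemma Ip_radial_axisZ m (e p eta r : R) : p != 0 -> 0 < e <= 1 -> 0 < eta -> 0 < r ->
  Ip_radial (square e) p (@flat_ellipsoid R m eta) (axis_vec m r r) =
  r^-1 * fine (wint (ellipsoid_slice (m * 2) eta) (square_kernel e p 1 1)) `^ (- p^-1).
Proof.
move=> p0 he eta0 r0; have e0 : 0 < e by case/andP: he.
have [mw wb _ _] := slab_density_ellipsoid_slice (m * 2) eta0.
have w0 z : 0 <= ellipsoid_slice (m * 2) eta z by case/andP: (wb z).
rewrite /Ip_radial support_integral_flat//.
have -> : square_kernel e p r r = (fun z => r `^ p * square_kernel e p 1 1 z).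
  by apply/funext => z; rewrite -square_kernelZ// mulr1.
rewrite (wintZ mw w0 (@measurable_square_kernel R e p 1 1)
  (@square_kernel_ge0 R e p 1 1) (powR_ge0 _ _)).
have i0 : 0 <= fine (wint (ellipsoid_slice (m * 2) eta) (square_kernel e p 1 1)).
  by rewrite fine_ge0//; apply: wint_ge0 => // z; exact: square_kernel_ge0.
rewrite fine_mule ?powR_gt0// powRM ?powR_ge0//.
by rewrite -powRrM mulrN divff// powR_inv1// ltW.
Qed.

End final.

Theorem proposition4p12 (R : realType) (n : nat) (hn : (0 < n)%N) (p : R)
    (hp : -1 <= p < 1) (hp0 : p != 0) :
  exists (C : set 'rV[R]_2) (K : set 'M[R]_(n, 2)),
    [/\ convex_body0 C,
        ellipsoid K,
        origin_symmetric K &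
        ~ convex_set (complex_Lp_intersection_body C p K)].
Proof.
case: n hn => // m _.
pose A : R := 2 ^+ (m * 2).
pose c : R := ((m * 2).+1%:R^-1 *+ 2) ^+ (m * 2).
have A0 : 0 < A by exact: exprn_gt0.
have c0 : 0 < c by rewrite exprn_gt0// pmulrn_lgt0// invr_gt0.
have [e [eta [sigma [he eta0 [s0 [s1 s2] s3]]]]] : exists e eta sigma : R,
    [/\ 0 < e <= 1, 0 < eta & [/\ 0 < sigma,
     sigma <= fine (wint (ellipsoid_slice (m * 2) eta) (square_kernel e p 1 0)) `^ (- p^-1) /\
     sigma <= fine (wint (ellipsoid_slice (m * 2) eta) (square_kernel e p 0 1)) `^ (- p^-1) &
     fine (wint (ellipsoid_slice (m * 2) eta) (square_kernel e p 1 1)) `^ (- p^-1) < sigma / 2]].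
  have hw := @slab_density_ellipsoid_slice R (m * 2).
  have [p0|p0] := ltP p 0.
    by apply: (square_kernel_gap_neg _ A0 c0 hw); lra.
  apply: (square_kernel_gap_pos _ A0 c0 hw).
  by rewrite lt_neqAle eq_sym hp0 p0; case/andP: hp.
have e0 : 0 < e by case/andP: he.
pose r : R := Num.sqrt 2^-1.
have r0 : 0 < r by rewrite sqrtr_gt0 invr_gt0.
have r2 : r ^+ 2 = 2^-1 by rewrite sqr_sqrtr// invr_ge0.
exists (square e), (@flat_ellipsoid R m eta); split.
- exact: convex_body0_square.
- exact: ellipsoid_flat.
- exact: origin_symmetric_flat.
apply: (not_convex_of_gap r0 r2 s0); rewrite ?Ip_radial_axisZ//.
- by rewrite /Ip_radial support_integral_flat.
- by rewrite /Ip_radial support_integral_flat.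
(* Cancelling 1 / r turns the required bound into the planar inequality [s3]. *)
rewrite -mulr_natr invfM mulrCA ltr_pM2l ?invr_gt0//.
Qed.
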